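(* Let $n$ be a positive integer. Let $T$ be the semigroup generated by symbols $\tau_{i,j}$, $i,j\in\{1,\dots,n\}$, $i\neq j$, subject to the following defining relations (where $i,j,k,l$ run over all pairwise different elements of $\{1,\dots,n\}$): $$\tau_{i,j}=\tau_{j,i};\qquad \tau_{i,j}^2=\tau_{i,j};\qquad \tau_{i,j}\tau_{j,k}\tau_{k,l}=\tau_{i,j}\tau_{i,l}\tau_{k,l};\qquad \tau_{i,j}\tau_{i,k}\tau_{j,k}=\tau_{i,j}\tau_{j,k};$$ $$\tau_{i,j}\tau_{j,k}\tau_{i,j}=\tau_{i,j};\qquad \tau_{i,j}\tau_{k,l}\tau_{i,k}=\tau_{i,j}\tau_{j,l}\tau_{i,k};\qquad \tau_{i,j}\tau_{k,l}=\tau_{k,l}\tau_{i,j}.$$ Then the homomorphism $\varphi:T\to\mathfrak{B}_n\setminus\mathcal{S}_n$ sending $\tau_{i,j}$ to $\sigma_{i,j}$ for all $i\ne j$ is an isomorphism of semigroups.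
   Context: Put $\mathbf{n}=\{1,\dots,n\}$ and $\mathbf{n}'=\{1',\dots,n'\}$ (a disjoint copy). The Brauer semigroup $\mathfrak{B}_n$ is the set of all partitions of $\mathbf{n}\cup\mathbf{n}'$ into two-element blocks. The product $\pi\tau$ is defined by concatenation: identify each $x'$ of $\pi$ with the element $x$ of $\tau$, take the graph whose edges are the blocks of $\pi$ and of $\tau$, and let two of the remaining $2n$ outer points (the unprimed points of $\pi$ and the primed points of $\tau$) be in the same block of $\pi\tau$ iff they are joined by a path in this graph (closed loops in the middle are discarded). This is a monoid with identity $\{\{k,k'\}_{k\in\mathbf{n}}\}$. $\mathcal{S}_n\subset\mathfrak{B}_n$ is the group of invertible elements, i.e. the elements all of whose blocks have the form $\{i,j'\}$; $\mathfrak{B}_n\setminus\mathcal{S}_n$ is the subsemigroup of non-invertible elements. For $i\neq j$ in $\mathbf{n}$, $\sigma_{i,j}=\{\{i,j\},\{i',j'\},\{k,k'\}_{k\neq i,j}\}\in\mathfrak{B}_n\setminus\mathcal{S}_n$. (The elements $\sigma_{i,j}$ satisfy the listed relations, so the homomorphism $\varphi$ is well defined. For $n=1$ there are no generators and both semigroups are empty.) *)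

(* Defs.v *)
From HB Require Import structures.
From mathcomp Require Import all_boot.
From mathcomp Require Import boolp.

Set Implicit Arguments.
Unset Strict Implicit.
Unset Printing Implicit Defensive.

Local Open Scope quotient_scope.

Section FreeSemigroup.
Variable A : choiceType.

(* Nonempty words, so that a presented semigroup has no adjoined identity. *)
Definition free_semigroup := {w : seq A | w != [::]}.
HB.instance Definition _ := SubChoice.on free_semigroup.

Implicit Types u v w : free_semigroup.

Fact cat_neq_nil u v : val u ++ val v != [::].
Proof. by case: u v => [[|a u] //= _] [v _]. Qed.

Definition free_mul u v : free_semigroup := Sub (val u ++ val v) (cat_neq_nil u v).

Fact free_mulA : associative free_mul.
Proof. by move=> u v w; apply: val_inj; rewrite /= catA. Qed.

HB.instance Definition _ := isSemigroup.Build free_semigroup free_mulA.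

Definition letter (a : A) : free_semigroup := Sub [:: a] isT.

Section Presentation.
Variable R : free_semigroup -> free_semigroup -> Prop.

Inductive congruence : free_semigroup -> free_semigroup -> Prop :=
| cong_rel u v of R u v : congruence u v
| cong_refl u : congruence u u
| cong_sym u v of congruence u v : congruence v u
| cong_trans u v w of congruence u v & congruence v w : congruence u w
| cong_mul u u' v v' of congruence u u' & congruence v v' :
    congruence (u * v)%g (u' * v')%g.

(* Classical reflection [< _ >] turns the congruence into a boolean relation, as
   {eq_quot _} requires; no decidability of the word problem is needed. *)
Definition congruenceb : rel free_semigroup := fun u v => `[< congruence u v >].

Fact congruenceb_equiv : equiv_class_of congruenceb.
Proof.
split=> [u|u v|v u w].
- exact/asboolP/cong_refl.
- by apply/asboolP/asboolP; apply: cong_sym.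
- by move=> /asboolP uv /asboolP vw; apply/asboolP/(cong_trans uv).
Qed.

Canonical congruenceb_rel := EquivRelPack congruenceb_equiv.

Definition presented_semigroup := {eq_quot congruenceb_rel}.
HB.instance Definition _ := Choice.on presented_semigroup.
HB.instance Definition _ := EqQuotient.on presented_semigroup.

Lemma eq_presentedP u v :
  reflect (congruence u v) (\pi_presented_semigroup u == \pi_presented_semigroup v).
Proof. by rewrite eqmodE; apply: asboolP. Qed.

Definition presented_mul (x y : presented_semigroup) : presented_semigroup :=
  \pi_presented_semigroup (repr x * repr y)%g.

Lemma presented_mulE u v :
  presented_mul (\pi_presented_semigroup u) (\pi_presented_semigroup v)
  = \pi_presented_semigroup (u * v)%g.
Proof.
by apply/eqP/eq_presentedP/cong_mul; apply/eq_presentedP; rewrite ?reprK.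
Qed.

Fact presented_mulA : associative presented_mul.
Proof.
elim/quotW=> u; elim/quotW=> v; elim/quotW=> w.
by rewrite (presented_mulE v) (presented_mulE u v) !presented_mulE mulgA.
Qed.

HB.instance Definition _ :=
  isSemigroup.Build presented_semigroup presented_mulA.

End Presentation.
End FreeSemigroup.

(* [inl k] is the point k and [inr k] is the point k'. *)
Definition points (n : nat) : finType := ('I_n + 'I_n)%type.

Definition is_brauer n (P : {set {set points n}}) :=
  partition P [set: points n] && [forall B in P, #|B| == 2].

Definition brauer n := {P : {set {set points n}} | is_brauer P}.
HB.instance Definition _ n := SubFinite.on (brauer n).

Section Concatenation.
Variable n : nat.
Implicit Types (P Q : {set {set points n}}) (u v w : points n).

(* The vertices of the graph of pi * tau are the unprimed points of pi, then
   the middle points, each being both x' in pi and x in tau, then the primed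
   points of tau. *)
Definition vertices : finType := ('I_n + 'I_n + 'I_n)%type.

Definition upper u : vertices := inl u.
Definition lower u : vertices :=
  match u with inl k => inl (inr k) | inr k => inr k end.
Definition outer u : vertices :=
  match u with inl k => inl (inl k) | inr k => inr k end.

Definition edges P Q : {set {set vertices}} :=
  [set upper @: B | B : {set _} in P] :|: [set lower @: B | B : {set _} in Q].

(* Two vertices of the same edge; the pairs (x, x) do not affect connectivity. *)
Definition adjacent P Q : rel vertices :=
  fun x y => [exists E in edges P Q, (x \in E) && (y \in E)].

Definition concat P Q : {set {set points n}} :=
  equivalence_partition
    (fun u v => connect (adjacent P Q) (outer u) (outer v)) [set: points n].

End Concatenation.

Section BrauerTheory.
Variable n : nat.
Implicit Types (P Q : brauer n) (u v w : points n).

Definition same_block P : rel (points n) :=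
  fun u v => v \in pblock (val P) u.

Fact brauer_partition P : partition (val P) [set: points n].
Proof. by case/andP: (valP P). Qed.

Fact card_pblock P u : #|pblock (val P) u| = 2.
Proof.
have [/and3P[/eqP cP _ _] /forall_inP P2] := andP (valP P).
by apply/eqP/P2/pblock_mem; rewrite cP.
Qed.

Fact same_block_refl P u : same_block P u u.
Proof. by rewrite /same_block mem_pblock; case/and3P: (brauer_partition P) => /eqP->. Qed.

Fact same_block_eq P u v : same_block P u v = (pblock (val P) u == pblock (val P) v).
Proof.
case/and3P: (brauer_partition P) => /eqP cP tP _.
by rewrite eq_pblock ?cP.
Qed.

Fact same_block_sym P : symmetric (same_block P).
Proof. by move=> u v; rewrite !same_block_eq eq_sym. Qed.

Fact same_block_trans P : transitive (same_block P).
Proof. by move=> v u w; rewrite !same_block_eq => /eqP->. Qed.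

Fact same_blockP P u v :
  reflect (exists2 B, B \in val P & (u \in B) && (v \in B)) (same_block P u v).
Proof.
case/and3P: (brauer_partition P) => /eqP cP tP _.
apply: (iffP idP) => [uv|[B BP /andP[uB vB]]].
  exists (pblock (val P) u); first by rewrite pblock_mem ?cP.
  by rewrite -/(same_block P u u) same_block_refl.
by rewrite /same_block (def_pblock tP BP uB).
Qed.

Definition partner P u : points n := odflt u [pick v in pblock (val P) u :\ u].

Fact pblock_partner P u :
  (partner P u != u) && (pblock (val P) u == [set u; partner P u]).
Proof.
have uu : u \in pblock (val P) u := same_block_refl P u.
have D1 : #|pblock (val P) u :\ u| == 1.
  by have := cardsD1 u (pblock (val P) u); rewrite uu card_pblock add1n => -[/esym/eqP].
case/cards1P: D1 => v Dv.
rewrite /partner; case: pickP => [w|/(_ v)]; last by rewrite Dv inE eqxx.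
rewrite Dv inE => /eqP -> /=.
have : v \in pblock (val P) u :\ u by rewrite Dv inE.
rewrite !inE => /andP[-> _] /=.
by rewrite -(setD1K uu) Dv.
Qed.

Fact partner_neq P u : partner P u != u.
Proof. by case/andP: (pblock_partner P u). Qed.

Fact same_blockE P u v : same_block P u v = (v == u) || (v == partner P u).
Proof. by rewrite /same_block; case/andP: (pblock_partner P u) => _ /eqP->; rewrite !inE. Qed.

Fact partnerK P : involutive (partner P).
Proof.
move=> u; apply/esym/eqP.
have : same_block P (partner P u) u by rewrite same_block_sym same_blockE eqxx orbT.
by rewrite same_blockE eq_sym (negPf (partner_neq P u)).
Qed.

Fact eq_brauer P Q : subrel (same_block P) (same_block Q) -> P = Q.
Proof.
move=> sPQ; apply: val_inj.
rewrite -(equivalence_partition_pblock (brauer_partition P)).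
rewrite -(equivalence_partition_pblock (brauer_partition Q)).
apply: eq_imset => u; apply/setP=> v; rewrite !inE -!/(same_block _ _ _).
have := sPQ u (partner P u).
rewrite !same_blockE eqxx orbT (negPf (partner_neq P u)) => /(_ isT) /eqP->.
by [].
Qed.

Lemma is_brauerP (R : {set {set points n}}) :
    (forall u, exists2 B, B \in R & u \in B) ->
    (forall u B C, B \in R -> C \in R -> u \in B -> u \in C -> B = C) ->
    (forall B, B \in R -> #|B| = 2) ->
  is_brauer R.
Proof.
move=> ex un R2; apply/andP; split; last by apply/forall_inP=> B /R2->.
apply/and3P; split.
- by apply/eqP/setP=> u; rewrite inE; case: (ex u) => B BR uB; apply/bigcupP; exists B.
- apply/trivIsetP=> B C BR CR; apply: contraNT => /pred0Pn[u /andP[/= uB uC]].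
  by apply/eqP; apply: (un u).
- by apply/negP=> /R2; rewrite cards0.
Qed.

Fact upper_inj : injective (@upper n). Proof. by move=> u v []. Qed.
Fact lower_inj : injective (@lower n).
Proof. by move=> [u|u] [v|v] // []->. Qed.
Fact outer_inj : injective (@outer n).
Proof. by move=> [u|u] [v|v] // []->. Qed.

Fact adjacentP P Q x y :
  reflect (exists u v, [/\ x = upper u, y = upper v & same_block P u v] \/
                       [/\ x = lower u, y = lower v & same_block Q u v])
          (adjacent (val P) (val Q) x y).
Proof.
apply: (iffP exists_inP) => [[E]|[u [v []]]].
- rewrite inE => /orP[] /imsetP[B BP ->] /andP[/imsetP[u uB ->] /imsetP[v vB ->]];
  exists u, v; [left|right]; split=> //; apply/same_blockP; exists B => //;
  by rewrite uB.
- case=> -> -> /same_blockP[B BP /andP[uB vB]]; exists (@upper n @: B).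
    by rewrite inE imset_f.
  by rewrite !imset_f.
- case=> -> -> /same_blockP[B BP /andP[uB vB]]; exists (@lower n @: B).
    by rewrite inE orbC imset_f.
  by rewrite !imset_f.
Qed.

Fact adjacent_sym P Q : symmetric (adjacent (val P) (val Q)).
Proof.
by move=> x y; apply: eq_existsb => E; congr (_ && _); apply: andbC.
Qed.

Fact concat_equiv P Q : {in [set: points n] & &, equivalence_rel
  (fun u v => connect (adjacent (val P) (val Q)) (outer u) (outer v))}.
Proof.
move=> u v w _ _ _; split=> [|uv]; first exact: connect0.
exact: (same_connect (sym_connect_sym (@adjacent_sym P Q)) uv).
Qed.

Fact mem_concat P Q u v :
  (v \in pblock (concat (val P) (val Q)) u) =
  connect (adjacent (val P) (val Q)) (outer u) (outer v).
Proof. by rewrite (pblock_equivalence_partition (@concat_equiv P Q)) ?inE. Qed.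

End BrauerTheory.

Lemma connect_ind (V : finType) (e : rel V) (S : V -> Prop) x z :
    S x -> (forall a b, S a -> e a b -> S b) -> connect e x z -> S z.
Proof.
move=> Sx Se /connectP[p + ->] {z}.
by elim: p x Sx => //= a p IH x Sx /andP[/(Se _ _ Sx) Sa]; apply: IH.
Qed.

(* In the graph spanned by two involutions f and g, a component containing a
   point fixed by g but not by f contains exactly one other point fixed by f
   or by g. *)
Lemma involutions_fixpoints (V : finType) (f g : V -> V) (e : rel V) x :
    involutive f -> involutive g ->
    (forall y, connect e y (f y)) -> (forall y, connect e y (g y)) ->
    (forall y z, e y z -> [\/ z = y, z = f y | z = g y]) ->
    g x = x -> f x != x ->
  exists2 y, y != x &
    forall z, connect e x z && ((f z == z) || (g z == z)) = (z == x) || (z == y).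
Proof.
move=> fK gK ef eg efg gx fx; pose h z := g (f z).
have h_inj : injective h by apply: (inj_comp (inv_inj gK) (inv_inj fK)).
have hgh z : h (g (h z)) = g z by rewrite /h gK fK.
have eh z : connect e z (h z) by apply: connect_trans (eg _).
have ek k : connect e x (iter k h x).
  by elim: k => //= k IH; apply: connect_trans (eh _).
have gk k : iter k h (g (iter k h x)) = x.
  by elim: k => [|k IH]; [exact: gx | rewrite iterSr /= hgh].
have fk k : iter k.+1 h (f (iter k h x)) = x.
  by rewrite iterSr; have -> : h (f (iter k h x)) = g (iter k h x) by rewrite /h fK.
have eE z : connect e x z -> fconnect h x z.
  apply: (@connect_ind _ _ (fconnect h x)) => [|a b /[dup] xa /iter_findex ha /efg[->|->|->]].
  - exact: connect0.
  - exact: xa.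
  - by rewrite fconnect_sym // -[X in fconnect h _ X](fk (findex h x a)) ha fconnect_iter.
  - by rewrite fconnect_sym // -[X in fconnect h _ X](gk (findex h x a)) ha fconnect_iter.
pose m := order h x; have m_gt0 : 0 < m := order_gt0 h x.
have per j : iter j h x = x -> m %| j.
  have itm q : iter (q * m) h x = x.
    by elim: q => // q IH; rewrite mulSn iterD IH iter_order.
  rewrite {1}(divn_eq j m) addnC iterD itm => jx.
  have := findex_iter (ltn_pmod j m_gt0); rewrite jx findex0 => /esym j0.
  exact/eqP.
have it_inj k : injective (iter k h) by elim: k => // k IH a b /h_inj /IH.
pose K := m./2.
have KE k : k < m -> (m %| k + k) || (m %| (k + k).+1) -> k = 0 \/ k = K.
  move=> km; case/orP=> /dvdnP[[|[|q]]]; rewrite ?mul0n ?mul1n ?mulSn /K => km2.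
  - by left; case: k km2 {km}.
  - by right; rewrite -km2 addnn doubleK.
  - by have := leq_add km (ltnW km); rewrite addSn km2 addnA -[X in _ < X]addn0 ltn_add2l.
  - by [].
  - by right; rewrite -km2 addnn /= uphalf_double.
  - have := leq_add km km; rewrite addSn addnS km2 addnA.
    by rewrite -addnS -[X in _ <= X]addn0 leq_add2l.
have K_lt : K < m by rewrite /K ltn_half_double -addnn -addn1 leq_add2l.
have fixK : (f (iter K h x) == iter K h x) || (g (iter K h x) == iter K h x).
  have mE := odd_double_half m; rewrite -/K -addnn in mE.
  have mx : iter m h x = x by apply: iter_order.
  case: (odd m) mE => mE; apply/orP; [left|right]; apply/eqP.
    by apply: (it_inj K.+1); rewrite fk -iterD -[LHS]mx -mE add1n addSn.
  by apply: (it_inj K); rewrite gk -iterD -[LHS]mx -mE.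
exists (iter K h x).
  apply: contra fx => /eqP /per; rewrite /dvdn modn_small // => /eqP K0.
  have m1 : m = 1 by move: m_gt0 K0; rewrite /K; case: (m) => [|[]].
  have := iter_order h_inj x; rewrite -/m m1 /= => /(congr1 g).
  by rewrite /h gK gx => ->.
move=> z; apply/andP/orP => [[/eE /[dup] xz /iter_findex <-]|].
  set k := findex h x z; move=> zfix.
  have km : k < m by apply: findex_max.
  have : (m %| k + k) || (m %| (k + k).+1).
    case/orP: zfix => /eqP zfix; apply/orP; [right|left]; apply: per.
      by have := fk k; rewrite zfix -iterD addSn.
    by have := gk k; rewrite zfix -iterD.
  by case/(KE _ km)=> ->; [left|right].
case=> /eqP->; first by rewrite connect0 gx eqxx orbT.
by split; first exact: ek.
Qed.

Section BrauerMonoid.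
Variable n : nat.
Implicit Types (P Q R : brauer n) (u v w : points n) (x y z : vertices n).

Let upper_partner P x : vertices n :=
  match x with inl u => upper (partner P u) | inr k => inr k end.
Let lower_partner Q x : vertices n :=
  match x with
  | inl (inl k) => inl (inl k)
  | inl (inr k) => lower (partner Q (inl k))
  | inr k => lower (partner Q (inr k))
  end.

Let upper_partnerK P : involutive (upper_partner P).
Proof. by case=> //= u; rewrite partnerK. Qed.

Let lower_partnerE Q u : lower_partner Q (lower u) = lower (partner Q u).
Proof. by case: u. Qed.

Let lower_partnerK Q : involutive (lower_partner Q).
Proof.
by case=> [[//|k]|k] /=; rewrite lower_partnerE partnerK.
Qed.

Let upper_fix P x : (upper_partner P x == x) = if x is inr _ then true else false.
Proof.
case: x => [u|k]; last by rewrite eqxx.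
by rewrite (inj_eq (@upper_inj n)) (negPf (partner_neq P u)).
Qed.

Let lower_fix Q x :
  (lower_partner Q x == x) = if x is inl (inl _) then true else false.
Proof.
case: x => [[k|k]|k]; first by rewrite eqxx.
  by rewrite (inj_eq (@lower_inj n) _ (inl k)) (negPf (partner_neq Q _)).
by rewrite (inj_eq (@lower_inj n) _ (inr k)) (negPf (partner_neq Q _)).
Qed.

Fact concat_brauer P Q : is_brauer (concat (val P) (val Q)).
Proof.
apply/andP; split; first exact/equivalence_partitionP/concat_equiv.
apply/forall_inP=> B /imsetP[u _ ->].
set e := adjacent (val P) (val Q); pose f := upper_partner P; pose g := lower_partner Q.
have ef x : connect e x (f x).
  case: x => [v|k] /=; last exact: connect0.
  apply/connect1/adjacentP; exists v, (partner P v); left; split=> //.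
  by rewrite same_blockE eqxx orbT.
have eg x : connect e x (g x).
  have egl v : connect e (lower v) (lower (partner Q v)).
    apply/connect1/adjacentP; exists v, (partner Q v); right; split=> //.
    by rewrite same_blockE eqxx orbT.
  by case: x => [[k|k]|k]; [exact: connect0|exact: (egl (inl k))|exact: (egl (inr k))].
have efg x y : e x y -> [\/ y = x, y = f x | y = g x].
  case/adjacentP=> v [w [] [-> -> ]]; rewrite same_blockE => /orP[]/eqP->.
  - by constructor 1.
  - by constructor 2.
  - by constructor 1.
  - by constructor 3; rewrite /g lower_partnerE.
have [y yu yE] : exists2 y, y != outer u & forall z,
    connect e (outer u) z && ((f z == z) || (g z == z)) = (z == outer u) || (z == y).
  case: u => k.
    apply: involutions_fixpoints => //; first exact: upper_partnerK.
      exact: lower_partnerK.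
    by rewrite upper_fix.
  have [|||||y yu yE] := @involutions_fixpoints _ g f e (outer (inr k)) _ _ eg ef.
  - exact: lower_partnerK.
  - exact: upper_partnerK.
  - by move=> x y /efg[]; [constructor 1|constructor 3|constructor 2].
  - by [].
  - by rewrite lower_fix.
  by exists y => // z; rewrite orbC yE.
have outP z : reflect (exists w, z = outer w) ((f z == z) || (g z == z)).
  rewrite upper_fix lower_fix; apply: (iffP idP) => [|[[] k ->] //].
  by case: z => [[k|//]|k] _; [exists (inl k)|exists (inr k)].
have [v yv] : exists v, y = outer v.
  by apply/outP; have := yE y; rewrite eqxx orbT => /andP[].
have vu : u != v by apply: contra yu => /eqP->; rewrite yv.
suff -> : [set w in [set: points n] | connect e (outer u) (outer w)] = [set u; v].
  by rewrite cards2 vu.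
apply/setP=> w; rewrite !inE /= -!(inj_eq (@outer_inj n)) -yv -yE.
by rewrite [X in _ = _ && X](introT (outP _)) ?andbT //; exists w.
Qed.

Definition brauer_mul P Q : brauer n := Sub (concat (val P) (val Q)) (concat_brauer P Q).

Fact same_block_mul P Q u v :
  same_block (brauer_mul P Q) u v =
  connect (adjacent (val P) (val Q)) (outer u) (outer v).
Proof. exact: mem_concat. Qed.

Section Associativity.
Variables P Q R : brauer n.

Let vertices4 : finType := (vertices n + 'I_n)%type.
Let bot (x : vertices n) : vertices4 :=
  match x with
  | inl (inl k) => inl (inl (inr k))
  | inl (inr k) => inl (inr k)
  | inr k => inr k
  end.
Let skip2 (x : vertices n) : vertices4 :=
  match x with
  | inl (inl k) => inl (inl (inl k))
  | inl (inr k) => inl (inr k)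
  | inr k => inr k
  end.
Let skip3 (x : vertices n) : vertices4 :=
  match x with
  | inl (inl k) => inl (inl (inl k))
  | inl (inr k) => inl (inl (inr k))
  | inr k => inr k
  end.

Let A : rel vertices4 := fun s t =>
  `[< exists x y, [/\ s = bot x, t = bot y & adjacent (val Q) (val R) x y] >].
Let B : rel vertices4 := fun s t =>
  `[< exists u v, [/\ s = inl (upper u), t = inl (upper v) & same_block P u v] >].
Let E := relU A B.
Let E3 := adjacent (val P) (concat (val Q) (val R)).

Let subA s t : connect A s t -> connect E s t.
Proof. by apply: connect_sub => a b ab; apply: connect1; rewrite /E /= ab. Qed.

Let subB s t : B s t -> connect E s t.
Proof. by move=> st; apply: connect1; rewrite /E /= st orbT. Qed.

Let bot_inj : injective bot.
Proof. by move=> [[a|a]|a] [[b|b]|b] // []->. Qed.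

Let skip3_inj : injective skip3.
Proof. by move=> [[a|a]|a] [[b|b]|b] // []->. Qed.

Let connectA s t : connect A s t ->
  s = t \/ exists x y,
    [/\ s = bot x, t = bot y & connect (adjacent (val Q) (val R)) x y].
Proof.
apply: (@connect_ind _ _ (fun t => s = t \/ exists x y,
    [/\ s = bot x, t = bot y & connect (adjacent (val Q) (val R)) x y])).
  by left.
move=> a b [<-|[x [y [-> -> xy]]]] /asboolP[x' [y' [xE -> xy']]]; right.
  by exists x', y'; split=> //; apply: connect1.
exists x, y'; split=> //; apply: connect_trans xy _; apply: connect1.
by rewrite (bot_inj xE).
Qed.

Let bot_skip3 x y : bot x = skip3 y -> exists u, x = outer u /\ y = lower u.
Proof.
by case: x y => [[a|a]|a] [[b|b]|b] // []->; [exists (inl b)|exists (inr b)].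
Qed.

Let connectA3 x y : connect A (skip3 x) (skip3 y) -> connect E3 x y.
Proof.
case/connectA=> [/skip3_inj->|[a [b [xa yb ab]]]]; first exact: connect0.
have [u [au ->]] := bot_skip3 (esym xa); have [v [bv ->]] := bot_skip3 (esym yb).
apply/connect1/(@adjacentP _ P (brauer_mul Q R)); exists u, v; right; split=> //.
by rewrite same_block_mul -au -bv.
Qed.

Let connectE3 x y : connect E (skip3 x) (skip3 y) -> connect E3 x y.
Proof.
pose S t := exists2 z, connect E3 x z & connect A (skip3 z) t.
move=> xy; suff [z xz /connectA3] : S (skip3 y) by apply: connect_trans.
have skipU u : inl (upper u) = skip3 (upper u) by case: u.
apply: (connect_ind _ _ xy) => [|s t [z xz zs] /orP[st|]].
- by exists x; apply: connect0.
- by exists z => //; apply: connect_trans zs _; apply: connect1.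
- case/asboolP=> u [v [su -> uv]]; rewrite skipU.
  exists (upper v); last exact: connect0.
  move: zs; rewrite su skipU => /connectA3 zu.
  apply: connect_trans xz _; apply: connect_trans zu _.
  by apply/connect1/(@adjacentP _ P (brauer_mul Q R)); exists u, v; left.
Qed.

Let connect_inl x y : adjacent (val P) (val Q) x y -> connect E (inl x) (inl y).
Proof.
case/adjacentP=> u [v [] [-> -> uv]].
  by apply/subB/asboolP; exists u, v.
have lowU w : inl (lower w) = bot (upper w) by case: w.
rewrite !lowU; apply/subA/connect1/asboolP; exists (upper u), (upper v).
by split=> //; apply/adjacentP; exists u, v; left.
Qed.

Let connect_skip2 x y :
  adjacent (concat (val P) (val Q)) (val R) x y -> connect E (skip2 x) (skip2 y).
Proof.
case/(@adjacentP _ (brauer_mul P Q) R)=> u [v [] [-> ->]].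
  rewrite same_block_mul => uv.
  have skipU w : skip2 (upper w) = inl (outer w) by case: w.
  rewrite !skipU; apply: (connect_ind (S := fun t => connect E (inl (outer u)) (inl t))) uv.
    exact: connect0.
  by move=> a b ua /connect_inl; apply: connect_trans.
move=> uv; have skipL w : skip2 (lower w) = bot (lower w) by case: w.
rewrite !skipL; apply/subA/connect1/asboolP; exists (lower u), (lower v).
by split=> //; apply/adjacentP; exists u, v; right.
Qed.

Fact brauer_mulA_aux : brauer_mul P (brauer_mul Q R) = brauer_mul (brauer_mul P Q) R.
Proof.
apply/esym/eq_brauer => u v; rewrite !same_block_mul /= => uv.
have skipO w : skip3 (outer w) = skip2 (outer w) by case: w.
apply: connectE3; rewrite !skipO.
apply: (connect_ind (S := fun t => connect E (skip2 (outer u)) (skip2 t))) uv.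
  exact: connect0.
by move=> a b ua /connect_skip2; apply: connect_trans.
Qed.

End Associativity.

Fact brauer_mulA : associative brauer_mul.
Proof. exact: brauer_mulA_aux. Qed.

Definition brauer1_set : {set {set points n}} := [set [set inl k; inr k] | k : 'I_n].

Fact brauer1_subproof : is_brauer brauer1_set.
Proof.
apply: is_brauerP => [u|u B C /imsetP[k _ ->] /imsetP[l _ ->]|B /imsetP[k _ ->]].
- by case: u => k; exists [set inl k; inr k]; do ?[exact: imset_f]; rewrite !inE eqxx ?orbT.
- by rewrite !inE => /orP[]/eqP-> /orP[] // /eqP[->].
- by rewrite cards2.
Qed.

Definition brauer1 : brauer n := Sub brauer1_set brauer1_subproof.

Fact same_block1 k : same_block brauer1 (inl k) (inr k).
Proof.
by apply/same_blockP; exists [set inl k; inr k]; [exact: imset_f | rewrite !inE !eqxx ?orbT].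
Qed.

Fact brauer_mul1 : left_id brauer1 brauer_mul.
Proof.
move=> P; apply/esym/eq_brauer => u v uv; rewrite same_block_mul.
have ol w : connect (adjacent (val brauer1) (val P)) (outer w) (lower w).
  case: w => k; last exact: connect0.
  by apply/connect1/adjacentP; exists (inl k), (inr k); left; rewrite same_block1.
apply: connect_trans (ol u) _.
rewrite (sym_connect_sym (@adjacent_sym _ _ _)); apply: connect_trans (ol v) _.
by apply/connect1/adjacentP; exists v, u; right; rewrite same_block_sym.
Qed.

Fact brauer_mulr1 : right_id brauer1 brauer_mul.
Proof.
move=> P; apply/esym/eq_brauer => u v uv; rewrite same_block_mul.
have ol w : connect (adjacent (val P) (val brauer1)) (outer w) (upper w).
  case: w => k; first exact: connect0.
  apply/connect1/adjacentP; exists (inr k), (inl k); right.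
  by rewrite same_block_sym same_block1.
apply: connect_trans (ol u) _.
rewrite (sym_connect_sym (@adjacent_sym _ _ _)); apply: connect_trans (ol v) _.
by apply/connect1/adjacentP; exists v, u; left; rewrite same_block_sym.
Qed.

End BrauerMonoid.

HB.instance Definition _ n :=
  isMonoid.Build (brauer n) (@brauer_mulA n) (@brauer_mul1 n) (@brauer_mulr1 n).

Definition invertible_brauer n : {pred brauer n} :=
  [pred P | [exists Q : brauer n, (P * Q == 1)%g && (Q * P == 1)%g]].

Section Invertible.
Variable n : nat.
Implicit Types (P Q : brauer n) (u v : points n) (k l : 'I_n).

Fact same_block1E u v :
  same_block (1%g : brauer n) u v =
  (v == u) || (v == match u with inl k => inr k | inr k => inl k end).
Proof.
rewrite same_blockE; congr (_ || (_ == _)).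
have E k : partner (1%g : brauer n) (inl k) = inr k.
  by have := same_block1 k; rewrite same_blockE => /eqP->.
by case: u => k //; rewrite -E partnerK.
Qed.

Fact same_block_mull P Q k l :
  same_block P (inl k) (inl l) -> same_block (P * Q)%g (inl k) (inl l).
Proof.
move=> kl; rewrite same_block_mul; apply/connect1/adjacentP.
by exists (inl k), (inl l); left.
Qed.

Fact same_block_mulr P Q k l :
  same_block Q (inr k) (inr l) -> same_block (P * Q)%g (inr k) (inr l).
Proof.
move=> kl; rewrite same_block_mul; apply/connect1/adjacentP.
by exists (inr k), (inr l); right.
Qed.

Definition flip_point u : points n :=
  match u with inl k => inr k | inr k => inl k end.

Fact flip_pointK : involutive flip_point. Proof. by case. Qed.

Fact flip_subproof P : is_brauer [set flip_point @: B | B : {set points n} in val P].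
Proof.
have flip_inj := inv_inj flip_pointK.
apply: is_brauerP => [u|u _ _ /imsetP[B BP ->] /imsetP[C CP ->]|_ /imsetP[B BP ->]].
- have /same_blockP[B BP /andP[uB _]] := same_block_refl P (flip_point u).
  by exists (flip_point @: B); [exact: imset_f | rewrite -[u]flip_pointK imset_f].
- rewrite -[u]flip_pointK !mem_imset // => uB uC.
  case/and3P: (brauer_partition P) => _ tP _.
  by rewrite -(def_pblock tP BP uB) -(def_pblock tP CP uC).
- case/andP: (valP P) => _ /forall_inP/(_ _ BP)/eqP <-; exact: card_imset.
Qed.

Definition flip P : brauer n := Sub _ (flip_subproof P).

Fact same_block_flip P u v :
  same_block P u v -> same_block (flip P) (flip_point u) (flip_point v).
Proof.
case/same_blockP=> B BP /andP[uB vB]; apply/same_blockP.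
by exists (flip_point @: B); [exact: imset_f | rewrite !imset_f].
Qed.

Lemma invertible_brauerP P :
  reflect (forall B, B \in val P -> exists i j, B = [set inl i; inr j])
          (P \in @invertible_brauer n).
Proof.
apply: (iffP existsP) => [[Q /andP[/eqP PQ /eqP QP]] B BP|PB].
  have [/and3P[_ tP P0] /forall_inP P2] := andP (valP P).
  case/cards2P: (P2 _ BP) => u [v [uv BE]].
  have : same_block P u v by apply/same_blockP; exists B; rewrite // BE !inE !eqxx orbT.
  case: u v uv BE => [k|k] [l|l] kl BE.
  - move=> /(same_block_mull Q); rewrite PQ same_block1E eq_sym.
    by rewrite (negPf kl).
  - by exists k, l.
  - by exists l, k; rewrite BE setUC.
  - move=> /(same_block_mulr Q); rewrite QP same_block1E eq_sym.
    by rewrite (negPf kl).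
have Pl k : exists l, same_block P (inl k) (inr l).
  case/same_blockP: (same_block_refl P (inl k)) => B BP /andP[kB _].
  have [i [j BE]] := PB _ BP; exists j; apply/same_blockP; exists B => //.
  by rewrite kB BE !inE eqxx orbT.
have Pr k : exists l, same_block P (inr k) (inl l).
  case/same_blockP: (same_block_refl P (inr k)) => B BP /andP[kB _].
  have [i [j BE]] := PB _ BP; exists i; apply/same_blockP; exists B => //.
  by rewrite kB BE !inE eqxx.
have eq1 Q : (forall k, same_block Q (inl k) (inr k)) -> Q = 1%g.
  move=> Qk; apply/esym/eq_brauer => u v; rewrite same_block1E.
  case/orP=> /eqP->; first exact: same_block_refl.
  by case: u => k //; rewrite same_block_sym.
exists (flip P); apply/andP; split; apply/eqP/eq1 => k; rewrite same_block_mul.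
  have [l kl] := Pl k; apply: (@connect_trans _ _ (upper (inr l))); apply/connect1/adjacentP.
    by exists (inl k), (inr l); left.
  exists (inl l), (inr k); right; split=> //.
  by rewrite same_block_sym; apply: (same_block_flip kl).
have [l kl] := Pr k; apply: (@connect_trans _ _ (upper (inr l))); apply/connect1/adjacentP.
  by exists (inl k), (inr l); left; split=> //; apply: (same_block_flip kl).
by exists (inl l), (inr k); right; rewrite same_block_sym.
Qed.

Fact noninvertible_closed : mulg_closed [predC @invertible_brauer n].
Proof.
move=> P Q; rewrite !inE => nP _; apply: contra nP => /existsP[S /andP[/eqP PQS _]].
have PW : (P * (Q * S) = 1)%g by rewrite mulgA.
have WK : cancel (fun U : brauer n => Q * S * U)%g (fun U => P * U)%g.
  by move=> U; rewrite mulgA PW mul1g.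
have [g _ Wg] := injF_bij (can_inj WK).
apply/existsP; exists (Q * S)%g; rewrite PW eqxx /=.
have /= WU := Wg 1%g; suff <- : g 1%g = P by rewrite WU.
by rewrite -(WK (g 1%g)) /= WU mulg1.
Qed.

End Invertible.

Definition singular_brauer n := {P : brauer n | [predC @invertible_brauer n] P}.
HB.instance Definition _ n := SubFinite.on (singular_brauer n).
HB.instance Definition _ n :=
  SubChoice_isSubSemigroup.Build (brauer n) [predC @invertible_brauer n]
    (singular_brauer n) (@noninvertible_closed n).

Section Sigma.
Variables (n : nat) (i j : 'I_n).

Definition sigma_set : {set {set points n}} :=
  [set [set inl i; inl j]; [set inr i; inr j]] :|:
  [set [set inl k; inr k] | k : 'I_n & (k != i) && (k != j)].

Variable ij : i != j.

Fact sigma_brauer : is_brauer sigma_set.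
Proof.
apply: is_brauerP => [u|u B C|B].
- case: u => k.
    have [ki|/norP[ki kj]] := boolP ((k == i) || (k == j)).
      by exists [set inl i; inl j]; rewrite !inE ?eqxx.
    exists [set inl k; inr k]; last by rewrite !inE eqxx.
    by rewrite inE; apply/orP; right; apply: imset_f; rewrite inE ki.
  have [ki|/norP[ki kj]] := boolP ((k == i) || (k == j)).
    by exists [set inr i; inr j]; rewrite !inE ?eqxx ?orbT.
  exists [set inl k; inr k]; last by rewrite !inE eqxx orbT.
  by rewrite inE; apply/orP; right; apply: imset_f; rewrite inE ki.
- have H (D : {set points n}) : D \in sigma_set -> u \in D ->
      D = match u with
          | inl k => if (k == i) || (k == j) then [set inl i; inl j]
                     else [set inl k; inr k]
          | inr k => if (k == i) || (k == j) then [set inr i; inr j]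
                     else [set inl k; inr k]
          end.
    rewrite !inE => /orP[/orP[]/eqP->|/imsetP[k]].
    + by rewrite !inE => /orP[]/eqP->; rewrite eqxx ?orbT.
    + by rewrite !inE => /orP[]/eqP->; rewrite eqxx ?orbT.
    + by rewrite inE => /andP[/negPf ki /negPf kj] ->; rewrite !inE => /orP[]/eqP->; rewrite ki kj.
  by move=> BS CS uB uC; rewrite (H B) // (H C).
- rewrite !inE => /orP[/orP[]/eqP->|/imsetP[k _ ->]]; rewrite cards2 //.
  + by rewrite (inj_eq (@inl_inj _ _)) ij.
  + by rewrite (inj_eq (@inr_inj _ _)) ij.
Qed.

Definition sigma_elt : brauer n := Sub sigma_set sigma_brauer.

Fact sigma_noninvertible : [predC @invertible_brauer n] sigma_elt.
Proof.
apply/negP=> /invertible_brauerP/(_ [set inl i; inl j])[|k [l /setP/(_ (inr l))]].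
  by rewrite !inE eqxx.
by rewrite !inE eqxx orbT.
Qed.

Definition sigma : singular_brauer n := Sub sigma_elt sigma_noninvertible.

End Sigma.

Definition tau_symbol (n : nat) := {p : 'I_n * 'I_n | p.1 != p.2}.
HB.instance Definition _ n := SubChoice.on (tau_symbol n).

Definition tau_word n (i j : 'I_n) (ij : i != j) : free_semigroup (tau_symbol n) :=
  letter (Sub (i, j) ij : tau_symbol n).

(* Each relation ranges over all choices of pairwise different indices among
   those occurring in it. *)
Inductive tau_relation n :
  free_semigroup (tau_symbol n) -> free_semigroup (tau_symbol n) -> Prop :=
| tau_sym (i j : 'I_n) (ij : i != j) (ji : j != i) :
    tau_relation (tau_word ij) (tau_word ji)
| tau_idem (i j : 'I_n) (ij : i != j) :
    tau_relation (tau_word ij * tau_word ij)%g (tau_word ij)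
| tau_ij_jk_kl (i j k l : 'I_n) (ij : i != j) (ik : i != k) (il : i != l)
    (jk : j != k) (jl : j != l) (kl : k != l) :
    tau_relation (tau_word ij * tau_word jk * tau_word kl)%g
                 (tau_word ij * tau_word il * tau_word kl)%g
| tau_ij_ik_jk (i j k : 'I_n) (ij : i != j) (ik : i != k) (jk : j != k) :
    tau_relation (tau_word ij * tau_word ik * tau_word jk)%g
                 (tau_word ij * tau_word jk)%g
| tau_ij_jk_ij (i j k : 'I_n) (ij : i != j) (ik : i != k) (jk : j != k) :
    tau_relation (tau_word ij * tau_word jk * tau_word ij)%g
                 (tau_word ij)
| tau_ij_kl_ik (i j k l : 'I_n) (ij : i != j) (ik : i != k) (il : i != l)
    (jk : j != k) (jl : j != l) (kl : k != l) :
    tau_relation (tau_word ij * tau_word kl * tau_word ik)%g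
                 (tau_word ij * tau_word jl * tau_word ik)%g
| tau_ij_kl (i j k l : 'I_n) (ij : i != j) (ik : i != k) (il : i != l)
    (jk : j != k) (jl : j != l) (kl : k != l) :
    tau_relation (tau_word ij * tau_word kl)%g (tau_word kl * tau_word ij)%g.

Definition tau_semigroup n : semigroupType :=
  presented_semigroup (@tau_relation n).

Definition tau n (i j : 'I_n) (ij : i != j) : tau_semigroup n :=
  \pi_(presented_semigroup (@tau_relation n)) (tau_word ij).

(* Main.v *)
(* Let T act by left multiplication on T with an identity adjoined. A "hole" of
   an element y is a pair {a, b} with tau_ab y = y; for every index c, tau_bc y
   then plays the role of y with a and c exchanged among its upper points. Every
   word is obtained by such moves from an idempotent e_f, the product of the
   tau_ab over the pairs {a, b} of an involution f; the moves multiply up to a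
   permutation pi, and the image of the word in the Brauer semigroup is e_f with
   its upper points permuted by pi.

   The value of a sequence of moves depends only on pi: moves can be made
   through a single hole, and an index m outside the initial hole is eliminated
   by following its image, the elements of the sequence being those of a sequence
   that fixes m, acted on by the transposition of m and its image. Hence words
   with the same image differ by a permutation that commutes with f and fixes the
   indices fixed by f, and such a permutation leaves e_f unchanged. *)
From HB Require Import structures.
Require Import Defs.
From mathcomp Require Import all_boot all_fingroup.

Set Implicit Arguments.
Unset Strict Implicit.
Unset Printing Implicit Defensive.

Local Open Scope quotient_scope.
Local Open Scope group_scope.

#[local] Hint Extern 0 (is_true (_ != _)) => rewrite eq_sym; assumption : core.

(* The relations of T, for the left multiplications t i j of T with an identity
   adjoined. The convention t i i = id makes the relations hold for more indices
   than the defining ones; thus tau_ij tau_ik tau_jk = tau_ij tau_jk becomes an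
   instance of [tau_path]. *)
Record tau_action n (X : Type) (t : 'I_n -> 'I_n -> X -> X) : Prop := TauAction {
  tau_id : forall i x, t i i x = x;
  tau_C : forall i j x, t i j x = t j i x;
  tau_I : forall i j x, t i j (t i j x) = t i j x;
  tau_comm : forall i j k l x, i != k -> i != l -> j != k -> j != l ->
    t i j (t k l x) = t k l (t i j x);
  tau_absorb : forall i j k x, i != j -> t i j (t j k (t i j x)) = t i j x;
  tau_path : forall i j k l x, i != j -> k != l ->
    t i j (t j k (t k l x)) = t i j (t i l (t k l x));
  tau_fork : forall i j k l x, i != j -> i != k ->
    t i j (t k l (t i k x)) = t i j (t j l (t i k x))
}.

(** * Identities in an action of T, and transpositions made through a hole *)

Section TauAction.
Variables (n : nat) (X : Type) (t : 'I_n -> 'I_n -> X -> X).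
Hypothesis tP : tau_action t.
Implicit Types (i j k l a b c d m q : 'I_n) (x y z : X).

Let tii := tau_id tP.
Let tC := tau_C tP.
Let tI := tau_I tP.
Let t_comm := tau_comm tP.
Let t_absorb := tau_absorb tP.
Let t_path := tau_path tP.
Let t_fork := tau_fork tP.

Lemma tau_triangle i j k x : i != j -> j != k ->
  t i j (t i k (t j k x)) = t i j (t j k x).
Proof. by move=> ij jk; rewrite -t_path // tii. Qed.

Lemma tau_triangle_rev i j k x : i != j -> k != i ->
  t i j (t j k (t k i x)) = t i j (t k i x).
Proof. by move=> ij ki; rewrite t_path // tii. Qed.

Lemma tau_absorbC i j k x : i != j -> t i j (t i k (t i j x)) = t i j x.
Proof. by move=> ij; rewrite (tC i j x) [LHS]tC t_absorb. Qed.

(** In the Brauer picture both moves turn the upper blocks {a, b}, {c, d} into {b, c}, {a, d}. *)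
Lemma tau_two_holes a b c d y : a != b -> c != d -> a != c -> a != d -> b != c -> b != d ->
  t a b y = y -> t c d y = y -> t b c y = t a d y.
Proof.
move=> ab cd ac ad bc bd yab ycd.
transitivity (t c b (t b a (t c d y))); first by rewrite ycd (tC b a) yab tC.
rewrite -t_fork // t_comm // (tC c d) t_fork //.
by rewrite (tC d c) ycd yab tC.
Qed.

(** Both sides exchange m and q through the hole {a, b}; the end that stays in place is b on the
    left and a on the right. *)
Lemma tau_swap_center a b m q x : a != b -> a != m -> a != q -> b != m -> b != q -> m != q ->
  t a b (t b m (t b q (t a b x))) = t a b (t a m (t a q (t a b x))).
Proof.
move=> ab am aq bm bq mq.
rewrite -(tau_triangle (k := m)) // (tC b m) (t_path (i := a)) //.
by rewrite (tC a b x) (tC b q) tau_triangle_rev.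
Qed.

Lemma tau_swap_order a b m q x : a != b -> a != m -> a != q -> b != m -> b != q -> m != q ->
  t a b (t b m (t b q (t a b x))) = t a b (t b q (t b m (t a b x))).
Proof.
move=> ab am aq bm bq mq; rewrite tau_swap_center //.
rewrite (tC a m) (tC a b x) -(tau_triangle (i := m)) // (tC m a) (tC a b).
rewrite (t_path (i := b)) // (tC b a x) (tC a q) (t_path (i := m)) //.
by rewrite (tC m q) tau_triangle_rev // (tC b a) (tC m b).
Qed.

(* be ab bm bq ab = be ab am aq ab = be me am aq ab = be bm me am aq ab
     = be bm me qe aq ab = be bm me qe be ab = be bm bq qe be ab = be bm bq be ab. *)
Lemma tau_swap_comm a b e m q x :
  a != b -> a != e -> a != m -> a != q -> b != e -> b != m -> b != q ->
  e != m -> e != q -> m != q ->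
  t b e (t a b (t b m (t b q (t a b x)))) = t b e (t b m (t b q (t b e (t a b x)))).
Proof.
move=> ab ae am aq be bm bq em eq mq.
rewrite tau_swap_center // (tC b e) (tC a b) (t_path (i := e)) // (tC e b).
rewrite -(tau_triangle (i := b)) // (tC a m) (t_path (i := e)) //.
rewrite (tC a q) (t_path (i := e)) // (tC e m) (t_path (i := b)) //.
by rewrite (tC e q) tau_triangle_rev // [in LHS](tC e b).
Qed.

(* ab bc bd de ab = ab bc ce de ab = ab bc ab ce de = ab ce de = ce de ab. *)
Lemma tau_two_holes_tperm a b c d e x :
  a != b -> a != c -> a != d -> a != e -> b != c -> b != d -> b != e -> d != e ->
  t a b (t b c (t b d (t d e (t a b x)))) = t c e (t d e (t a b x)).
Proof.
move=> ab ac ad ae bc bd be de.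
rewrite (tC b c) (t_path (i := c)) // (t_comm (i := d) (j := e)) // (t_comm (i := c) (j := e)) //.
by rewrite (tC c b) t_absorb // (t_comm (i := a) (j := b)) // (t_comm (i := a) (j := b)).
Qed.

(* The transposition of m and q among the upper points of y, made through the
   hole {a, b} of y, for m not in the hole. *)
Definition hole_tperm a b m q y :=
  if q == a then t m b y else if q == b then t m a y else t a b (t a q (t a m y)).

Lemma hole_tperm_id a b m y : a != b -> t a b y = y -> a != m -> b != m ->
  hole_tperm a b m m y = y.
Proof.
move=> ab yab am bm.
by rewrite /hole_tperm !ifN_eqC // tI (tC a b) -[in LHS]yab (tC a b) t_absorb // tC.
Qed.

Lemma hole_tpermE a b m q y :
    a != b -> t a b y = y -> a != m -> b != m -> a != q -> b != q -> m != q ->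
  hole_tperm a b m q y = t b a (t b m (t b q y)).
Proof.
move=> ab yab am bm aq bq mq; rewrite /hole_tperm !ifN_eqC //.
by rewrite -yab -tau_swap_center // tau_swap_order // (tC b a).
Qed.

Lemma hole_tpermE_rev a b m q y :
    a != b -> t a b y = y -> a != m -> b != m -> a != q -> b != q -> m != q ->
  hole_tperm a b m q y = t b a (t b q (t b m y)).
Proof.
move=> ab yab am bm aq bq mq; rewrite hole_tpermE //.
by rewrite -yab (tC b a) tau_swap_order.
Qed.

Lemma hole_tpermC a b m q y : a != b -> t a b y = y -> a != m -> b != m ->
  hole_tperm a b m q y = hole_tperm b a m q y.
Proof.
move=> ab yab am bm.
have [<-|mq] := eqVneq m q; first by rewrite !hole_tperm_id // tC.
have [->|qa] := eqVneq q a; first by rewrite /hole_tperm eqxx ifN.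
have [->|qb] := eqVneq q b; first by rewrite /hole_tperm eqxx ifN // eq_sym.
by rewrite hole_tpermE_rev // /hole_tperm !ifN.
Qed.

Lemma hole_step a b c y : a != b -> t a b y = y ->
  t (tperm a c a) (tperm a c b) (t b c y) = t b c y.
Proof.
move=> ab yab; rewrite tpermL.
case: tpermP => [ba|<-|_ _]; first by rewrite ba eqxx in ab.
  by rewrite tii tC.
by rewrite (tC c b) tI.
Qed.

(* A move of the transposed element is the transposition of m and the new image
   of m, applied to a move that does not involve m. *)
Lemma hole_tperm_step a b m q c y :
    a != b -> t a b y = y -> a != m -> b != m ->
  let a' := tperm m q a in let b' := tperm m q b in let q' := tperm a' c q in
  exists e, [/\ e != m, e \in [:: a; q; c],
    (tperm m q * tperm a' c * tperm m q' = tperm a e)%g &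
    t b' c (hole_tperm a b m q y) =
    hole_tperm (tperm a e a) (tperm a e b) m q' (t b e y)].
Proof.
move=> ab yab am bm a' b' q'.
have yba : t b a y = y by rewrite tC.
have a'q : a' != q.
  by rewrite -[q](tpermL m q) (inj_eq perm_inj).
(* Conjugation by [tperm m q] carries [tperm a' c] to [tperm a (tperm m q c)]. If c differs from q
   then [q' = q] and the last two factors cancel, so that e is [tperm m q c]. *)
have permE : (tperm m q * tperm a' c * tperm m q' =
              tperm a (tperm m q c) * (tperm m q * tperm m q'))%g.
  rewrite !mulgA; congr (_ * _)%g; rewrite -[c in LHS](tpermK m q).
  by rewrite -tpermJ conjgE !mulgA mulgV mul1g.
have [cq|cq] := eqVneq c q.
  have q'E : q' = a' by rewrite /q' cq tpermR.
  rewrite permE q'E cq tpermR; rewrite {permE q' q'E c cq}/b' /a' in a'q *.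
  have [qm|qm] := eqVneq q m.
    exists a; split=> //; first by rewrite inE eqxx.
      by rewrite qm tperm1 perm1 mul1g (tpermC m a) tperm2 tperm1.
    rewrite qm !tperm1 !perm1 hole_tperm_id // yba.
    by rewrite /hole_tperm eqxx tC.
  have [qa|qa] := eqVneq q a.
    exists a; split=> //; first by rewrite inE eqxx.
      by rewrite qa tpermR tperm1 mulg1 tpermC tperm2 tperm1.
    rewrite qa !tpermR tperm1 !perm1 yba hole_tperm_id // tpermD 1?eq_sym //.
    by rewrite /hole_tperm eqxx -[in LHS]yab (tC m b) (tC b a) t_absorb.
  have mqa : tperm m q a = a by rewrite tpermD // eq_sym.
  exists q; rewrite !inE eqxx orbT mqa; split; rewrite ?orbT //.
    by rewrite (tpermC m a) -{1}(tpermV a m) -conjgE tpermJ tpermR tpermD // eq_sym.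
  rewrite tpermL; have [qb|qb] := eqVneq q b.
    rewrite qb !tpermR /hole_tperm !eqxx !ifN //.
    by rewrite tii -[in LHS]yba tau_triangle // (tC m b) yba.
  rewrite !tpermD // hole_tpermE_rev //.
  have yq : t q b (t b q y) = t b q y by rewrite tC tI.
  rewrite [RHS]hole_tpermE //.
  by rewrite tau_absorbC // -[in RHS]yba tau_absorbC // yba.
have q'E : q' = q by rewrite /q' tpermD // eq_sym.
rewrite permE q'E tperm2 mulg1; rewrite {permE q' q'E}/b' /a' in a'q *.
have mcm : tperm m q c != m.
  by apply: contra cq => /eqP mc; rewrite -[c](tpermK m q) mc tpermL.
have [qm|qm] := eqVneq q m.
  rewrite qm !tperm1 !perm1 in mcm *.
  exists c; rewrite !inE eqxx !orbT; split=> //.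
  have cab : tperm a c a != tperm a c b by rewrite (inj_eq perm_inj).
  rewrite !hole_tperm_id ?hole_step // ?tpermL //.
  by case: tpermP => // <-.
have [qa|qa] := eqVneq q a.
  rewrite qa in mcm cq qm *.
  rewrite [tperm m a b]tpermD //.
  have [cm|cm] := eqVneq c m.
    rewrite cm tpermL; exists a; rewrite !inE eqxx; split=> //.
    by rewrite tperm1 !perm1 yba /hole_tperm eqxx (tC b m) tI.
  exists c; rewrite [tperm m a c]tpermD // !inE eqxx !orbT; split=> //.
  rewrite tpermL; have [cb|cb] := eqVneq c b.
    by rewrite cb !tii tpermR /hole_tperm eqxx ifN.
  rewrite tpermD // [RHS]hole_tpermE //; last by rewrite tC tI.
  by rewrite /hole_tperm eqxx -[in RHS]yba tau_absorbC // yba (tC m b).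
have [qb|qb] := eqVneq q b.
  rewrite qb in mcm cq qm *; rewrite tpermR.
  have [cm|cm] := eqVneq c m.
    rewrite cm tpermL; exists b; rewrite !inE eqxx !orbT; split=> //.
    by rewrite tpermL tpermR !tii /hole_tperm !eqxx !ifN.
  exists c; rewrite [tperm m b c]tpermD // !inE eqxx !orbT; split=> //.
  rewrite tpermL; have [ca|ca] := eqVneq c a.
    by rewrite ca tperm1 perm1 yba /hole_tperm eqxx ifN.
  rewrite tpermD // /hole_tperm !eqxx !ifN //.
  by rewrite (tC m c) (tC m c) -[in LHS]yab t_path // yab (tC c b).
rewrite [tperm m q b]tpermD //.
have [cm|cm] := eqVneq c m.
  rewrite cm tpermL; exists q; rewrite !inE eqxx !orbT; split=> //.
  rewrite tpermL tpermD // hole_tpermE // /hole_tperm eqxx.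
  by rewrite tau_absorbC // (tC b m).
have [ca|ca] := eqVneq c a.
  rewrite ca [tperm m q a]tpermD //; exists a; rewrite !inE eqxx; split=> //.
  by rewrite tperm1 !perm1 yba /hole_tperm !ifN // (tC b a) tI.
have [cb|cb] := eqVneq c b.
  rewrite cb [tperm m q b]tpermD //; exists b; rewrite !inE eqxx !orbT; split=> //.
  by rewrite tpermL tpermR !tii hole_tpermC.
(* Here a, b, m, q and c are all different, and [tau_swap_comm] lets the move pass the
   transposition. *)
exists c; rewrite [tperm m q c]tpermD // !inE eqxx !orbT; split=> //.
rewrite tpermL tpermD // hole_tpermE // [RHS]hole_tpermE //; last by rewrite tC tI.
by rewrite -[in LHS]yab (tC b a) tau_swap_comm // yab.
Qed.

End TauAction.

(** * Sequences of moves through a single hole *)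

Lemma tperm_hop (T : finType) (a c d : T) : a != c -> a != d ->
  tperm a c * tperm c d * tperm d a = tperm c d.
Proof.
move=> ac ad; have -> : tperm d a = tperm a c ^ tperm c d.
  by rewrite tpermJ tpermL tpermD 1?eq_sym // tpermC.
by rewrite -mulgA -conjgC mulgA tperm2 mul1g.
Qed.

Section Paths.
Variables (n : nat) (X : Type) (t : 'I_n -> 'I_n -> X -> X).
Hypothesis tP : tau_action t.
Implicit Types (a b c d m q : 'I_n) (x y z : X) (pi rho : 'S_n) (I : {set 'I_n}).

(* The moves from x through its hole {a, b} and its successive images, with the
   other exchanged index in I. *)
Inductive hole_path a b x I : 'S_n -> X -> Prop :=
| hole_path0 : hole_path a b x I 1 x
| hole_pathl pi y c : hole_path a b x I pi y -> c \in I ->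
    hole_path a b x I (pi * tperm (pi a) c) (t (pi b) c y)
| hole_pathr pi y c : hole_path a b x I pi y -> c \in I ->
    hole_path a b x I (pi * tperm (pi b) c) (t (pi a) c y).

(** The end [pi a] of the hole visits c and d and returns; the three transpositions compose to
    [tperm c d] by [tperm_hop]. *)
Lemma hole_path_tperm a b x I pi y c d : a != b ->
    hole_path a b x I pi y -> pi a \in I -> c \in I -> d \in I ->
    pi a != c -> pi a != d -> pi b != c -> pi b != d ->
  hole_path a b x I (pi * tperm c d) (t (pi b) (pi a) (t (pi b) d (t (pi b) c y))).
Proof.
move=> ab yP aI cI dI ac ad bc bd.
have pab : pi a != pi b by rewrite (inj_eq perm_inj).
have := hole_pathl (hole_pathl (hole_pathl yP cI) dI) aI.
rewrite !permM !tpermL !(tpermD (z := pi b)) // -!mulgA [_ * (_ * tperm d _)]mulgA tperm_hop //.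
Qed.

Lemma hole_pathC a b x I pi y : hole_path a b x I pi y -> hole_path b a x I pi y.
Proof.
elim=> [|{}pi {}y c _ yP cI|{}pi {}y c _ yP cI]; first exact: hole_path0.
  exact: hole_pathr.
exact: hole_pathl.
Qed.

Lemma hole_path_hole a b x I pi y : a != b -> t a b x = x ->
  hole_path a b x I pi y -> t (pi a) (pi b) y = y.
Proof.
move=> ab xab; elim=> [|{}pi {}y c _ yab _|{}pi {}y c _ yab _]; rewrite ?perm1 // !permM.
  by apply: (hole_step tP); rewrite ?(inj_eq perm_inj).
rewrite (tau_C tP); apply: (hole_step tP); first by rewrite (inj_eq perm_inj).
by rewrite (tau_C tP).
Qed.

Lemma hole_path_on a b x I pi y : a \in I -> b \in I -> hole_path a b x I pi y -> perm_on I pi.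
Proof.
move=> aI bI; have tpermI c d : c \in I -> d \in I -> perm_on I (tperm c d).
  move=> cI dI; apply: subset_trans (tperm_on c d) _.
  by apply/subsetP=> e; rewrite !inE => /orP[]/eqP->.
elim=> [|{}pi {}y c _ piI cI|{}pi {}y c _ piI cI]; first exact: perm_on1.
  by apply/perm_onM/tpermI => //; rewrite perm_closed.
by apply/perm_onM/tpermI => //; rewrite perm_closed.
Qed.

(** Both ends stay in {a, b}, so each move acts along the hole or along a repeated index and changes
    nothing. *)
Lemma hole_path_base a b x pi y : a != b -> t a b x = x ->
  hole_path a b x [set a; b] pi y -> y = x.
Proof.
move=> ab xab; have xba : t b a x = x by rewrite (tau_C tP).
have piab rho z : hole_path a b x [set a; b] rho z ->
    (rho a \in [set a; b]) && (rho b \in [set a; b]).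
  by move=> zP; rewrite !(perm_closed _ (hole_path_on _ _ zP)) !inE !eqxx ?orbT.
elim=> // {}pi {}y c yP -> /[!inE] cI; have /[!inE] /andP[pia pib] := piab _ _ yP.
  by case/orP: pib => /eqP->; case/orP: cI => /eqP->; rewrite ?(tau_id tP).
by case/orP: pia => /eqP->; case/orP: cI => /eqP->; rewrite ?(tau_id tP).
Qed.

(** Here [rho] is pi corrected so as to fix m. By [hole_tperm_step] the correcting transposition
    passes one more move, leaving a move that avoids m. *)
Lemma hole_path_elim_step a b x I m pi y z c :
    a != b -> t a b x = x -> a \in I -> b \in I -> m \notin I -> c \in m |: I -> pi m \in m |: I ->
    let rho := pi * tperm m (pi m) in
    hole_path a b x I rho z ->
    y = hole_tperm t (rho a) (rho b) m (pi m) z ->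
  let pi' := pi * tperm (pi a) c in let rho' := pi' * tperm m (pi' m) in
  exists2 z', hole_path a b x I rho' z' &
    t (pi b) c y = hole_tperm t (rho' a) (rho' b) m (pi' m) z'.
Proof.
move=> ab xab aI bI mI cI pimI rho zP yE pi' rho'.
have am : a != m by apply: contraNneq mI => <-.
have bm : b != m by apply: contraNneq mI => <-.
have rab : rho a != rho b by rewrite (inj_eq perm_inj).
have rho_m : rho m = m by rewrite permM tpermR.
have ram : rho a != m by rewrite -[m in _ != m]rho_m (inj_eq perm_inj).
have rbm : rho b != m by rewrite -[m in _ != m]rho_m (inj_eq perm_inj).
have piE d : tperm m (pi m) (rho d) = pi d by rewrite permM tpermK.
have := hole_tperm_step tP (pi m) c rab (hole_path_hole ab xab zP) ram rbm.
rewrite /= !piE => -[e [em eI pE yE']].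
have rho'E : rho' = rho * tperm (rho a) e.
  by rewrite -pE /rho' /pi' /rho !mulgA -(mulgA pi (tperm m _)) tperm2 mulg1 !permM.
exists (t (rho b) e z); rewrite rho'E.
  apply: hole_pathl => //.
  have : e \in m |: I.
    move: eI; rewrite !inE => /or3P[]/eqP->; [|by rewrite !inE in pimI|by rewrite !inE in cI].
    by have := perm_closed a (hole_path_on aI bI zP); rewrite aI => ->; rewrite orbT.
  by rewrite !inE (negPf em).
by rewrite !(permM rho) yE yE' !permM.
Qed.

Lemma hole_path_elim a b x I m pi y :
    a != b -> t a b x = x -> a \in I -> b \in I -> m \notin I ->
    hole_path a b x (m |: I) pi y ->
  let rho := pi * tperm m (pi m) in
  exists2 z, hole_path a b x I rho z & y = hole_tperm t (rho a) (rho b) m (pi m) z.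
Proof.
move=> ab xab aI bI mI; have xba : t b a x = x by rewrite (tau_C tP).
have am : a != m by apply: contraNneq mI => <-.
have bm : b != m by apply: contraNneq mI => <-.
have pimI rho z : hole_path a b x (m |: I) rho z -> rho m \in m |: I.
  by move=> /hole_path_on/perm_closed->; rewrite ?inE ?eqxx ?aI ?bI ?orbT.
elim=> [|{}pi {}y c yP [z zP yE] cI|{}pi {}y c yP [z zP yE] cI].
- exists x; rewrite perm1 tperm1 mulg1 ?perm1 ?(hole_tperm_id tP) //.
  exact: hole_path0.
- by apply: (hole_path_elim_step ab xab aI bI mI cI _ zP yE); apply: pimI yP.
(* A move of the other end is the case already treated with a and b exchanged, [hole_tperm] being
   symmetric in the two ends. *)
have tC rho d w : hole_path a b x I rho w ->
    rho m = m -> hole_tperm t (rho b) (rho a) m d w = hole_tperm t (rho a) (rho b) m d w.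
  move=> wP rhom; symmetry; apply: (hole_tpermC tP); first by rewrite (inj_eq perm_inj).
  - exact: hole_path_hole wP.
  - by rewrite -[m in _ != m]rhom (inj_eq perm_inj).
  - by rewrite -[m in _ != m]rhom (inj_eq perm_inj).
have pm rho : (rho * tperm m (rho m)) m = m by rewrite permM tpermR.
rewrite -tC // in yE.
have [||z' /hole_pathC zP' ->] := hole_path_elim_step _ xba bI aI mI cI _ (hole_pathC zP) yE => //.
  exact: pimI yP.
by exists z'; rewrite -?tC.
Qed.

(** Induction on the size of I: eliminating an index m outside the hole from both paths leaves paths
    within [I :\ m] with the same permutation. *)
Lemma hole_path_fun a b x I pi y z :
    a != b -> t a b x = x -> a \in I -> b \in I ->
  hole_path a b x I pi y -> hole_path a b x I pi z -> y = z.
Proof.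
move=> ab xab.
have [k] := ubnP #|I|; elim: k I pi y z => // k IH I pi y z Ik aI bI yP zP.
have [IE|] := boolP (I \subset [set a; b]).
  have IE' : I = [set a; b].
    by apply/eqP; rewrite eqEsubset IE; apply/subsetP=> c /[!inE] /orP[]/eqP->.
  by rewrite IE' in yP zP; rewrite (hole_path_base ab xab yP) (hole_path_base ab xab zP).
case/subsetPn=> m mI; rewrite !inE => /norP[ma mb].
rewrite -(setD1K mI) in yP zP.
have aI' : a \in I :\ m by rewrite !inE aI andbT.
have bI' : b \in I :\ m by rewrite !inE bI andbT.
have [y' y'P ->] := hole_path_elim ab xab aI' bI' (negbT (setD11 m I)) yP.
have [z' z'P ->] := hole_path_elim ab xab aI' bI' (negbT (setD11 m I)) zP.
congr hole_tperm; apply: IH y'P z'P => //.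
by move: Ik; rewrite (cardsD1 m I) mI add1n ltnS.
Qed.

End Paths.

(** * Moves through all the holes given by an involution *)

Section Reach.
Variables (n : nat) (X : Type) (t : 'I_n -> 'I_n -> X -> X).
Hypothesis tP : tau_action t.
Implicit Types (a b c d i j : 'I_n) (x y z : X) (f g pi rho : 'S_n).

(** A move may use any pair {a, f a}: the end [pi a] is exchanged with c and the end [pi (f a)] is
    kept. For an involution f either end may be the moving one. *)
Inductive reach f x : 'S_n -> X -> Prop :=
| reach0 : reach f x 1 x
| reachS pi y a c : reach f x pi y -> f a != a ->
    reach f x (pi * tperm (pi a) c) (t (pi (f a)) c y).

Definition has_holes f x := forall a, f a != a -> t a (f a) x = x.

Section Involution.
Variables (f : 'S_n) (x : X).
Hypotheses (fK : involutive f) (fx : has_holes f x).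

(** If a move of one pair runs into another pair, [tau_two_holes] rewrites it as the move joining
    the two remaining ends, so both new pairs are holes. *)
Lemma reach_hole pi y a : reach f x pi y -> f a != a -> t (pi a) (pi (f a)) y = y.
Proof.
move=> yP; elim: yP a => [|{}pi {}y b c _ IH fb] a fa.
  by rewrite !perm1 fx.
have pib : pi b != pi (f b) by rewrite (inj_eq perm_inj) eq_sym.
rewrite !permM.
have [->|ab] := eqVneq a b.
  exact: (hole_step tP c pib (IH _ fb)).
have [->|afb] := eqVneq a (f b).
  by rewrite fK (tau_C tP) (hole_step tP c pib (IH _ fb)).
have fab : f a != b by apply: contraNneq afb => <-; rewrite fK.
have pia : pi a != pi (f a) by rewrite (inj_eq perm_inj) eq_sym.
have [ya yb] := (IH _ fa, IH _ fb).
have [ba bfa fba fbfa] :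
    [/\ pi b != pi a, pi b != pi (f a), pi (f b) != pi a & pi (f b) != pi (f a)].
  by rewrite !(inj_eq perm_inj); split=> //; rewrite eq_sym.
have [ca|ca] := eqVneq c (pi a).
  rewrite ca tpermR tpermD // (tau_two_holes tP pib pia) // tau_I //.
have [cfa|cfa] := eqVneq c (pi (f a)).
  rewrite cfa tpermR tpermD // (tau_two_holes tP pib (c := pi (f a)) (d := pi a)) //.
    by rewrite (tau_C tP (pi a)) tau_I.
  by rewrite tau_C.
by rewrite !tpermD // (tau_comm tP) // ya.
Qed.

(** One hole does the work of all. A move of another pair that runs into the hole is rewritten by
    [tau_two_holes]; otherwise the end [pi a] visits [pi b] and c and returns, which gives their
    transposition. *)
Lemma reach_hole_path a pi y : f a != a -> reach f x pi y -> hole_path t a (f a) x setT pi y.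
Proof.
move=> fa; elim=> [|{}pi {}y b c yP IH fb]; first exact: hole_path0.
have [->|ba] := eqVneq b a; first by apply: hole_pathl; rewrite ?inE.
have [->|bfa] := eqVneq b (f a); first by rewrite fK; apply: hole_pathr; rewrite ?inE.
have pia : pi a != pi (f a) by rewrite (inj_eq perm_inj) eq_sym.
have pib : pi b != pi (f b) by rewrite (inj_eq perm_inj) eq_sym.
have fba : f b != a by apply: contraNneq bfa => <-; rewrite fK.
have fbfa : f b != f a by rewrite (inj_eq perm_inj).
have [ya yb] := (reach_hole yP fa, reach_hole yP fb).
have [ab afb fab fafb] :
    [/\ pi a != pi b, pi a != pi (f b), pi (f a) != pi b & pi (f a) != pi (f b)].
  by rewrite !(inj_eq perm_inj); split=> //; rewrite eq_sym.
have [cb|cb] := eqVneq c (pi b).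
  by rewrite cb tperm1 mulg1 (tau_C tP) yb.
have [ca|ca] := eqVneq c (pi a).
  rewrite ca tpermC (tau_C tP) -(tau_two_holes tP pia pib) //.
  by apply: hole_pathl; rewrite ?inE.
have [cfa|cfa] := eqVneq c (pi (f a)).
  rewrite cfa tpermC (tau_C tP) -(tau_two_holes tP (a := pi (f a)) (b := pi a) _ pib) //.
    by apply: hole_pathr; rewrite ?inE.
  by rewrite tau_C.
suff <- : t (pi (f a)) (pi a) (t (pi (f a)) c (t (pi (f a)) (pi b) y)) = t (pi (f b)) c y.
  by apply: hole_path_tperm; rewrite ?inE // eq_sym.
rewrite -[in LHS]yb -[in LHS]ya (tau_C tP _ (pi a)).
by rewrite (tau_two_holes_tperm tP) // ya yb (tau_C tP).
Qed.

(** Both sequences can be made through one hole, where [hole_path_fun] applies; if f is the identity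
    there are no moves. *)
Lemma reach_fun pi y z : reach f x pi y -> reach f x pi z -> y = z.
Proof.
have [f1|] := boolP [forall a, f a == a].
  have f1' w : reach f x pi w -> w = x.
    by case=> // rho v a c _; rewrite (eqP (forallP f1 a)) eqxx.
  by move=> /f1'-> /f1'->.
case/forallPn=> a fa yP zP; have af : a != f a by rewrite eq_sym.
have [ya za] := (reach_hole_path fa yP, reach_hole_path fa zP).
by apply: (hole_path_fun tP af (fx fa) (in_setT _) (in_setT _) ya za).
Qed.

(** Permutations are products of transpositions, and [tperm c d] is made by sending [rho a] to c, to
    d and back, or by one move if [rho a] is c or d. *)
Lemma reach_ex a : f a != a -> forall pi, exists y, reach f x pi y.
Proof.
move=> fa pi; have [ts -> _] := prod_tpermP pi.
elim/last_ind: ts => [|ts [c d] [y yP]]; first by exists x; rewrite big_nil; apply: reach0.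
rewrite big_rcons /=; move: {ts}(\prod_(_ <- ts) _) y yP => rho y yP.
have step sigma z e : reach f x sigma z -> exists z', reach f x (sigma * tperm (sigma a) e) z'.
  by move=> zP; exists (t (sigma (f a)) e z); apply: reachS.
have [<-|ac] := eqVneq (rho a) c; first exact: step yP.
have [<-|ad] := eqVneq (rho a) d; first by rewrite tpermC; apply: step yP.
have [y1 /(step _ _ d)[y2 /(step _ _ (rho a))[y3 y3P]]] := step _ _ c yP.
exists y3; rewrite -(tperm_hop ac ad).
by rewrite !permM !tpermL -!mulgA in y3P *.
Qed.

End Involution.

(** When i and j are fixed points of f, this is f with the pair {i, j} added. *)
Definition pair_up f i j : 'S_n := f * tperm i j.

Section AddPair.
Variables (f : 'S_n) (x : X) (i j : 'I_n).
Hypotheses (fK : involutive f) (fx : has_holes f x).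
Hypotheses (ij : i != j) (fi : f i = i) (fj : f j = j).

Lemma pair_up_neq a : a != i -> a != j -> (f a != i) * (f a != j).
Proof.
move=> ai aj; split.
  by rewrite -[X in _ != X]fi (inj_eq perm_inj).
by rewrite -[X in _ != X]fj (inj_eq perm_inj).
Qed.

Lemma pair_upE a : pair_up f i j a = if a == i then j else if a == j then i else f a.
Proof.
rewrite permM; case: eqVneq => [->|ai]; first by rewrite fi tpermL.
case: eqVneq => [->|aj]; first by rewrite fj tpermR.
by rewrite tpermD // eq_sym (pair_up_neq ai aj).
Qed.

Lemma pair_upK : involutive (pair_up f i j).
Proof.
move=> a; rewrite (pair_upE a); have [->|ai] := eqVneq a i.
  by rewrite pair_upE ifN // eqxx.
have [->|aj] := eqVneq a j; first by rewrite pair_upE eqxx.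
by rewrite pair_upE !ifN ?(pair_up_neq ai aj).
Qed.

Lemma pair_up_holes : has_holes (pair_up f i j) (t i j x).
Proof.
move=> a; rewrite pair_upE; have [-> _|ai] := eqVneq a i; first by rewrite tau_I.
have [-> _|aj fa] := eqVneq a j; first by rewrite (tau_C tP j) tau_I.
by rewrite (tau_comm tP) ?fx // (pair_up_neq ai aj).
Qed.

(** A letter joining the images of two fixed points of f can be absorbed into x, ahead of the moves:
    it commutes with every move that avoids these images. *)
Lemma reach_pair_up pi y : reach f x pi y ->
  reach (pair_up f i j) (t i j x) pi (t (pi i) (pi j) y).
Proof.
elim=> [|{}pi {}y a c yP IH fa]; first by rewrite !perm1; apply: reach0.
have ai : a != i by apply: contraNneq fa => ->; rewrite fi.
have aj : a != j by apply: contraNneq fa => ->; rewrite fj.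
have [fai faj] := pair_up_neq ai aj.
have f'a : pair_up f i j a = f a by rewrite pair_upE !ifN.
have := reachS c IH (_ : pair_up f i j a != a); rewrite f'a => /(_ fa).
congr reach; rewrite !permM.
have ya := reach_hole fK fx yP fa.
have aa : pi a != pi (f a) by rewrite (inj_eq perm_inj) eq_sym.
have pij : pi i != pi j by rewrite (inj_eq perm_inj).
have [ia ja iaf jaf] :
    [/\ pi i != pi a, pi j != pi a, pi i != pi (f a) & pi j != pi (f a)].
  by rewrite !(inj_eq perm_inj); split=> //; rewrite eq_sym.
(* If the move exchanges [pi a] with an end of the letter, the hole of y supplies the factor that
   [tau_fork] needs. *)
have line k l : k != l -> k != pi a -> l != pi a -> k != pi (f a) -> l != pi (f a) ->
    t (pi (f a)) k (t k l y) = t (pi a) l (t (pi (f a)) k y).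
  move=> kl ka la kfa lfa.
  by rewrite (tau_comm tP (i := pi a)) // -ya (tau_C tP _ (pi (f a)) y) (tau_fork tP).
have [->|ci] := eqVneq c (pi i); first by rewrite tpermR tpermD // line.
have [->|cj] := eqVneq c (pi j).
  by rewrite tpermR tpermD // (tau_C tP (pi i)) line // (tau_C tP (pi a)).
by rewrite !tpermD // (tau_comm tP).
Qed.

End AddPair.

End Reach.

(** * Words as sequences of moves from the idempotents e_f *)

Lemma involution_ind n (P : 'S_n -> Prop) :
    P 1 ->
    (forall (f : 'S_n) i j, involutive f -> i != j -> f i = i -> f j = j ->
      P f -> P (pair_up f i j)) ->
  forall f : 'S_n, involutive f -> P f.
Proof.
move=> P1 Padd f; have [k] := ubnP #|[pred a | f a != a]|.
elim: k f => // k IH f fk fK.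
have [/forallP f1|/forallPn[a fa]] := boolP [forall a, f a == a].
  by rewrite (_ : f = 1) //; apply/permP => a; rewrite perm1 (eqP (f1 a)).
pose g := f * tperm a (f a).
have fab c : c != a -> c != f a -> (f c != a) && (f c != f a).
  by move=> ca cfa; rewrite -{1}(fK a) !(inj_eq perm_inj) cfa.
have gE c : g c = if (c == a) || (c == f a) then c else f c.
  rewrite permM; case: eqVneq => [->|ca] /=; first by rewrite tpermR.
  case: eqVneq => [->|cfa]; first by rewrite fK tpermL.
  by have /andP[? ?] := fab _ ca cfa; rewrite tpermD.
have -> : f = pair_up g a (f a) by rewrite /pair_up -mulgA tperm2 mulg1.
have gK : involutive g.
  move=> c; rewrite (gE c); case: ifP => [|/negbT/norP[ca cfa]]; first by rewrite gE => ->.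
  by rewrite gE; have /andP[/negPf-> /negPf->] := fab _ ca cfa; rewrite fK.
apply: Padd; rewrite ?gE ?eqxx ?orbT //; apply: IH => //.
rewrite -ltnS; apply: leq_trans fk; rewrite ltnS; apply/proper_card/properP; split.
  by apply/subsetP=> c; rewrite !inE gE; case: ifP; rewrite ?eqxx.
by exists a; rewrite !inE ?gE ?eqxx.
Qed.

Section Words.
Variables (n : nat) (X : Type) (t : 'I_n -> 'I_n -> X -> X) (o : X).
Hypothesis tP : tau_action t.
Implicit Types (a b c d i j : 'I_n) (x y z : X) (f g pi rho : 'S_n).

(** The idempotent e_f applied to o; the test [c < f c] takes each pair once, at its smaller
    index. *)
Definition pairing_elt f :=
  foldr (fun c x => if c < f c then t c (f c) x else x) o (enum 'I_n).

Lemma pairing_elt1 : pairing_elt 1 = o.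
Proof. by rewrite /pairing_elt; elim: (enum _) => //= c s ->; rewrite perm1 ltnn. Qed.

Lemma pairing_elt_add f i j : i != j -> f i = i -> f j = j ->
  pairing_elt (pair_up f i j) = t i j (pairing_elt f).
Proof.
wlog ij : i j / i < j.
  move=> H ij fi fj; have [lij|lji|/val_inj E] := ltngtP i j; first exact: H.
    by rewrite /pair_up tpermC (tau_C tP); apply: H.
  by rewrite E eqxx in ij.
move=> neq_ij fi fj; rewrite /pairing_elt.
pose F h s := foldr (fun c x => if c < (h : 'S_n) c then t c (h c) x else x) o s.
(* In a duplicate-free list the new factor occurs at the smaller index i only, and it commutes to
   the front past the other pairs. *)
suff H s : uniq s -> F (pair_up f i j) s = if i \in s then t i j (F f s) else F f s.
  by have := H _ (enum_uniq 'I_n); rewrite mem_enum.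
elim: s => //= c s IH /andP[cs /IH->]; rewrite inE pair_upE //.
have [ci|ci] := eqVneq c i.
  by rewrite ci in cs *; rewrite fi ltnn (negPf cs) ij.
have [cj|cj] := eqVneq c j.
  by rewrite cj fj ltnn ltnNge (ltnW ij).
have [fci fcj] := pair_up_neq fi fj ci cj.
by case: ifP => // _; case: ifP => // _; rewrite (tau_comm tP).
Qed.

Lemma pairing_elt_holes f : involutive f -> has_holes t f (pairing_elt f).
Proof.
move: f; apply: involution_ind => [a|f i j fK ij fi fj fx]; first by rewrite perm1 eqxx.
by rewrite pairing_elt_add //; apply: pair_up_holes.
Qed.

(** The letter is pulled back by pi to indices i0 and j0. If f moves one of them, the letter is a
    move; otherwise [reach_pair_up] adds the pair {i0, j0} to f. *)
Lemma word_reach (w : seq ('I_n * 'I_n)) : all (fun p => p.1 != p.2) w ->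
  exists f pi, involutive f /\
    reach t f (pairing_elt f) pi (foldr (fun p => t p.1 p.2) o w).
Proof.
elim: w => [_|[i j] w IH /= /andP[ij /IH[f [pi [fK yP]]]]].
  exists 1, 1; split=> [a|]; first by rewrite !perm1.
  by rewrite pairing_elt1; apply: reach0.
move: (foldr _ _ _) yP => y yP; have fx := pairing_elt_holes fK.
pose i0 := pi^-1 i; pose j0 := pi^-1 j.
have [iE jE] : pi i0 = i /\ pi j0 = j by rewrite !permKV.
have [fi|fi] := eqVneq (f i0) i0; last first.
  exists f, (pi * tperm (pi (f i0)) j); split=> //; rewrite -iE -{2}(fK i0).
  by apply: reachS; rewrite // fK eq_sym.
have [fj|fj] := eqVneq (f j0) j0; last first.
  exists f, (pi * tperm (pi (f j0)) i); split=> //.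
  rewrite (tau_C tP) -jE -{2}(fK j0).
  by apply: reachS; rewrite // fK eq_sym.
have ij0 : i0 != j0 by rewrite (inj_eq perm_inj).
exists (pair_up f i0 j0), pi; split; first exact: pair_upK.
by rewrite pairing_elt_add // -iE -jE; apply: reach_pair_up.
Qed.

(** Permuting the upper points of the image of e_f by such a g leaves that image unchanged. *)
Definition stabilizes f g :=
  (forall a, g (f a) = f (g a)) /\ (forall a, f a = a -> g a = a).

Section Stabilizer.
Variables (f : 'S_n) (x : X).
Hypotheses (fK : involutive f) (fx : has_holes t f x).

Lemma reach_comp g rho z : stabilizes f g -> reach t f x g x -> reach t f x rho z ->
  reach t f x (g * rho) z.
Proof.
move=> [gf _] gP; elim=> [|{}rho {}z a c _ IH fa]; first by rewrite mulg1.
have aE : g (g^-1 a) = a by rewrite permKV.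
have fa' : f (g^-1 a) != g^-1 a by rewrite -(inj_eq (@perm_inj _ g)) gf aE.
by have := reachS c IH fa'; rewrite !permM gf aE -mulgA.
Qed.

(** Induction on the number of points moved by g: an involution h in the stabilizer, with explicit
    moves from x back to x, sends [g a] to a and fixes whatever g fixes, so [g * h] moves fewer
    points. *)
Lemma stabilizes_reach g : stabilizes f g -> reach t f x g x.
Proof.
have [k] := ubnP #|[pred a | g a != a]|; elim: k g => // k IH g gk [gf gfix].
have [/forallP g1|/forallPn[a ga]] := boolP [forall a, g a == a].
  by rewrite (_ : g = 1) ?perm1; [apply: reach0 | apply/permP=> a; rewrite perm1 (eqP (g1 a))].
have fa : f a != a by apply: contraNneq ga => /gfix->.
suff [h [hK hP hs hfix]] : exists h : 'S_n, [/\ involutive h, reach t f x h x, stabilizes f h &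
    h (g a) = a /\ forall c, g c = c -> h c = c].
  have hh : h * h = 1 by apply/permP=> c; rewrite permM hK perm1.
  have ghs : stabilizes f (g * h).
    split=> [c|c fc]; first by rewrite !permM gf hs.1.
    by rewrite permM (gfix _ fc) hs.2.
  rewrite -[g]mulg1 -hh mulgA; apply: reach_comp hP => //; apply: IH => //.
  rewrite -ltnS; apply: leq_trans gk; rewrite ltnS; apply/proper_card/properP; split.
    by apply/subsetP=> c; rewrite !inE permM; apply: contraNneq => gc; rewrite gc hfix.2.
  by exists a; rewrite !inE // permM hfix.1 eqxx.
have gfixE c : g (f c) = f c -> g c = c by rewrite gf => /perm_inj.
have [gafa|gafa] := eqVneq (g a) (f a).
  (* Flipping the pair of a is a move along a repeated index. *)
  exists (tperm a (f a)); rewrite gafa tpermR; split; first exact: tpermK.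
  - have := reachS (f a) (reach0 t f x) fa.
    by rewrite !perm1 mul1g (tau_id tP).
  - split=> [c|c fc]; last first.
      by apply: tpermD; apply: contra_neq fa => E; rewrite ?E // -(fK a) E.
    have [->|ca] := eqVneq c a; first by rewrite tpermL tpermR fK.
    have [->|cfa] := eqVneq c (f a); first by rewrite fK tpermL tpermR.
    have fca : f c != a by rewrite -(inj_eq (@perm_inj _ f)) fK.
    have fcfa : f c != f a by rewrite (inj_eq perm_inj).
    by rewrite !tpermD.
  - split=> // c gc; apply: tpermD; apply: contra_neq ga => E; first by rewrite E.
    by apply: gfixE; rewrite E.
set b := g a in gafa *.
have fb : f b != b by rewrite /b -gf (inj_eq perm_inj).
have ba : b != a by [].
have fab : f a != b by rewrite eq_sym.
have fba : f b != a by rewrite -(inj_eq (@perm_inj _ f)) fK.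
have fbfa : f b != f a by rewrite (inj_eq perm_inj).
have hE c : (tperm a b * tperm (f b) (f a)) c = if c == a then b else if c == b then a else
    if c == f a then f b else if c == f b then f a else c.
  rewrite permM; have [->|ca] := eqVneq c a; first by rewrite tpermL tpermD.
  have [->|cb] := eqVneq c b; first by rewrite tpermR tpermD.
  rewrite (tpermD (z := c)) //.
  have [->|cfa] := eqVneq c (f a); first by rewrite tpermR.
  have [->|cfb] := eqVneq c (f b); first by rewrite tpermL.
  by rewrite tpermD.
(* This h exchanges the pairs {a, f a} and {b, f b}; its two moves return to x by [tau_absorb]. *)
exists (tperm a b * tperm (f b) (f a)); split.
- move=> c; rewrite (hE c).
  have [->|ca] := eqVneq c a; first by rewrite hE (negPf ba) eqxx.
  have [->|cb] := eqVneq c b; first by rewrite hE eqxx.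
  have [->|cfa] := eqVneq c (f a).
    by rewrite hE (negPf fba) (negPf fb) (negPf fbfa) eqxx.
  have [->|cfb] := eqVneq c (f b).
    by rewrite hE (negPf fa) (negPf fab) eqxx.
  by rewrite hE !ifN.
- have ffb : f (f b) != f b by rewrite (inj_eq perm_inj).
  have := reachS (f a) (reachS b (reach0 t f x) fa) ffb.
  rewrite !perm1 mul1g fK tpermR (tpermD (z := f b)) //.
  suff -> : t a (f a) (t (f a) b x) = x by [].
  by rewrite -[in LHS](fx fa) (tau_absorb tP) ?fx // eq_sym.
- split=> c; last first.
    move=> fc; have neq d : f d != d -> c != d by apply: contraNneq => <-; rewrite fc.
    by rewrite hE !ifN ?neq ?fK // eq_sym.
  rewrite (hE c).
  have [->|ca] := eqVneq c a; first by rewrite hE (negPf fa) (negPf fab) eqxx.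
  have [->|cb] := eqVneq c b; first by rewrite hE (negPf fba) (negPf fb) (negPf fbfa) eqxx.
  have [->|cfa] := eqVneq c (f a); first by rewrite !fK hE eqxx.
  have [->|cfb] := eqVneq c (f b); first by rewrite !fK hE (negPf ba) eqxx.
  by rewrite hE !ifN ?(inj_eq perm_inj) // -(inj_eq (@perm_inj _ f)) fK.
- split=> [|c gc]; first by rewrite hE (negPf ba) eqxx.
  have neq d : g d != d -> c != d by apply: contraNneq => <-; rewrite gc.
  have gb : g b != b by rewrite /b (inj_eq perm_inj).
  have gf_neq d : g d != d -> g (f d) != f d by apply: contra_neq => /gfixE.
  by rewrite hE !ifN ?neq ?gf_neq.
Qed.

Lemma reach_stabilizes_eq pi rho y z :
  reach t f x pi y -> reach t f x rho z -> stabilizes f (pi * rho^-1) -> y = z.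
Proof.
move=> yP zP sP; apply: reach_fun yP _ => //.
by have := reach_comp sP (stabilizes_reach sP) zP; rewrite mulgKV.
Qed.

End Stabilizer.
End Words.

(** * Left multiplication by sigma_ij on partner functions *)

Section Partner.
Variable n : nat.
Implicit Types (P Q : brauer n) (i j k : 'I_n) (u v : points n) (p : points n -> points n).

Lemma partner_inj P Q : partner P =1 partner Q -> P = Q.
Proof. by move=> PQ; apply: eq_brauer => u v; rewrite !same_blockE PQ. Qed.

Lemma partner_eq P u v : v != u -> same_block P u v -> partner P u = v.
Proof. by move=> vu; rewrite same_blockE (negPf vu) => /eqP. Qed.

Lemma partner1 u : partner (1 : brauer n) u = flip_point u.
Proof. by apply: partner_eq; [case: u | rewrite same_block1E eqxx orbT]. Qed.

(* The partner function of sigma_ij P, for p that of P. *)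
Definition hook i j p u :=
  if u == inl i then inl j else if u == inl j then inl i
  else if p u == inl i then p (inl j) else if p u == inl j then p (inl i) else p u.

Lemma partner_sigma i j (ij : i != j) P :
  partner (sigma_elt ij * P) =1 hook i j (partner P).
Proof.
set Q := sigma_elt ij; have sc := sym_connect_sym (@adjacent_sym n Q P).
have con u v : u != v -> connect (adjacent (val Q) (val P)) (outer u) (outer v) ->
    partner (Q * P) u = v.
  by rewrite eq_sym => uv uvP; apply: partner_eq; rewrite ?same_block_mul.
have Q1 : same_block Q (inl i) (inl j).
  by apply/same_blockP; exists [set inl i; inl j]; rewrite !inE !eqxx ?orbT.
have Q2 : same_block Q (inr i) (inr j).
  by apply/same_blockP; exists [set inr i; inr j]; rewrite !inE !eqxx ?orbT.
have Q3 k : k != i -> k != j -> same_block Q (inl k) (inr k).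
  move=> ki kj; apply/same_blockP; exists [set inl k; inr k]; rewrite !inE ?eqxx ?orbT //.
  by apply/orP; right; apply/imsetP; exists k; rewrite // inE ki.
have low u : u != inl i -> u != inl j ->
    connect (adjacent (val Q) (val P)) (outer u) (lower u).
  case: u => k ki kj; last exact: connect0.
  apply/connect1/adjacentP; exists (inl k), (inr k); left; split=> //.
  by apply: Q3; [apply: contraNneq ki => -> | apply: contraNneq kj => ->].
have lowP u : connect (adjacent (val Q) (val P)) (lower u) (lower (partner P u)).
  by apply/connect1/adjacentP; exists u, (partner P u); right; rewrite same_blockE eqxx orbT.
have mid : connect (adjacent (val Q) (val P)) (lower (inl i)) (lower (inl j)).
  by apply/connect1/adjacentP; exists (inr i), (inr j); left.
move=> u; rewrite /hook.
have [->|ui] := eqVneq u (inl i).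
  by apply: con => //; apply/connect1/adjacentP; exists (inl i), (inl j); left.
have [->|uj] := eqVneq u (inl j).
  apply: con => //; rewrite sc.
  by apply/connect1/adjacentP; exists (inl i), (inl j); left.
(* The path reaches the middle point i, crosses the block {i', j'} of sigma_ij to the middle point
   j, and leaves along P. *)
have [pui|pui] := eqVneq (partner P u) (inl i).
  have pji : partner P (inl j) != inl i.
    by rewrite -pui (inj_eq (inv_inj (@partnerK _ P))).
  have puE : partner P (inl i) = u by rewrite -pui partnerK.
  have pju : partner P (inl j) != u.
    by rewrite -puE (inj_eq (inv_inj (@partnerK _ P))); apply: (contra_neq _ ij) => -[->].
  apply: con; rewrite 1?eq_sym //; apply: connect_trans (low u ui uj) _.
  apply: connect_trans (lowP u) _; rewrite pui; apply: connect_trans mid _.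
  apply: connect_trans (lowP _) _; rewrite sc; apply: low => //.
  exact: partner_neq.
have [puj|puj] := eqVneq (partner P u) (inl j).
  have puE : partner P (inl j) = u by rewrite -puj partnerK.
  have pij : partner P (inl i) != inl j.
    by rewrite -puj (inj_eq (inv_inj (@partnerK _ P))).
  have piu : partner P (inl i) != u.
    by rewrite -puE (inj_eq (inv_inj (@partnerK _ P))); apply: (contra_neq _ ij) => -[->].
  apply: con; rewrite 1?eq_sym //; apply: connect_trans (low u ui uj) _.
  apply: connect_trans (lowP u) _; rewrite puj; rewrite sc in mid.
  apply: connect_trans mid _.
  apply: connect_trans (lowP _) _; rewrite sc; apply: low => //.
  exact: partner_neq.
apply: con; first by rewrite eq_sym partner_neq.
apply: connect_trans (low u ui uj) _; apply: connect_trans (lowP u) _.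
by rewrite sc; apply: low.
Qed.

End Partner.

(** * The defining relations hold for the sigma_ij *)

Section Eval.
Variable n : nat.

Definition eval_word (w : seq (tau_symbol n)) : brauer n :=
  foldr (fun s P => sigma_elt (valP s) * P) 1 w.

Lemma eval_cat w1 w2 : eval_word (w1 ++ w2) = eval_word w1 * eval_word w2.
Proof. by elim: w1 => [|s w IH] /=; rewrite ?mul1g // IH mulgA. Qed.

Lemma eq_hook i j p q : p =1 q -> @hook n i j p =1 hook i j q.
Proof. by move=> pq u; rewrite /hook !pq. Qed.

Lemma hookE i j p u : @hook n i j p u =
  if u == inl i then inl j else if u == inl j then inl i
  else if p u == inl i then p (inl j) else if p u == inl j then p (inl i) else p u.
Proof. by []. Qed.

Lemma partner_eval_word w : partner (eval_word w) =1
  foldr (fun s : tau_symbol n => hook (val s).1 (val s).2) (@flip_point n) w.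
Proof.
elim: w => [|s w IH] u /=; first exact: partner1.
by rewrite partner_sigma; apply: eq_hook.
Qed.

Lemma neqE (T : eqType) (x y : T) : x != y -> ((x == y) = false) * ((y == x) = false).
Proof. by move=> xy; rewrite (eq_sym y) (negPf xy). Qed.

Lemma pointE :
  (forall k l : 'I_n, (inl k == inl l :> points n) = (k == l)) *
  (forall k l : 'I_n, (inr k == inl l :> points n) = false).
Proof. by []. Qed.

Local Ltac hook_eval E :=
  do ?[rewrite hookE ?(pointE, eqxx, E) /=]; rewrite ?(pointE, eqxx, E) //=.

Local Ltac hook_cases u i j k l E :=
  let m := fresh "m" in let mi := fresh "mi" in let mj := fresh "mj" in
  let mk := fresh "mk" in let ml := fresh "ml" in case: u => m;
  (have [->|/neqE mi] := eqVneq m i; first by hook_eval E);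
  (have [->|/neqE mj] := eqVneq m j; first by hook_eval E);
  (have [->|/neqE mk] := eqVneq m k; first by hook_eval E);
  (have [->|/neqE ml] := eqVneq m l; first by hook_eval E);
  by hook_eval (E, mi, mj, mk, ml).

Lemma sigma_relation v w : @tau_relation n v w -> eval_word (val v) = eval_word (val w).
Proof.
case=> {v w} [i j ij ji|i j ij|i j k l ij ik il jk jl kl|i j k ij ik jk|i j k ij ik jk
  |i j k l ij ik il jk jl kl|i j k l ij ik il jk jl kl];
apply: partner_inj => u; rewrite !partner_eval_word /=.
(* Relations in two or three indices repeat the last index to fill the four slots. *)
- hook_cases u i j j j (neqE ij).
- hook_cases u i j j j (neqE ij).
- hook_cases u i j k l (neqE ij, neqE ik, neqE il, neqE jk, neqE jl, neqE kl).
- hook_cases u i j k k (neqE ij, neqE ik, neqE jk).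
- hook_cases u i j k k (neqE ij, neqE ik, neqE jk).
- hook_cases u i j k l (neqE ij, neqE ik, neqE il, neqE jk, neqE jl, neqE kl).
- hook_cases u i j k l (neqE ij, neqE ik, neqE il, neqE jk, neqE jl, neqE kl).
Qed.

End Eval.

(** * The action of T on T with an identity adjoined *)

Section TauSemigroup.
Variable n : nat.
Local Notation class := (\pi_(presented_semigroup (@tau_relation n))).
Implicit Types (i j k l : 'I_n) (s : tau_symbol n).
Implicit Types (p q : tau_semigroup n) (x : option (tau_semigroup n)).

Lemma tau_class_eq v w : @tau_relation n v w -> class v = class w.
Proof. by move=> vw; apply/eqP/eq_presentedP/cong_rel. Qed.

Lemma tau_classM v w : class (v * w) = class v * class w :> tau_semigroup n.
Proof. by rewrite -presented_mulE. Qed.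

(* None is the adjoined identity. *)
Definition lmul_adj p x := Some (if x is Some q then p * q else p).

Lemma lmul_adjA p q x : lmul_adj p (lmul_adj q x) = lmul_adj (p * q) x.
Proof. by case: x => //= r; rewrite /lmul_adj mulgA. Qed.

(** [insub] fails exactly for [i = j], which gives the convention that [tau_adj i i] is the
    identity. *)
Definition tau_adj i j x :=
  if (insub (i, j) : option (tau_symbol n)) is Some s then lmul_adj (class (letter s)) x else x.

Lemma tau_adj_id i x : tau_adj i i x = x.
Proof. by rewrite /tau_adj insubN //= eqxx. Qed.

Lemma tau_adjE i j (ij : i != j) x : tau_adj i j x = lmul_adj (tau ij) x.
Proof. by rewrite /tau_adj (insubT (fun p : 'I_n * 'I_n => p.1 != p.2) (x := (i, j)) ij). Qed.

Lemma tau_adj_action : tau_action tau_adj.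
Proof.
have tC i j x : tau_adj i j x = tau_adj j i x.
  have [-> //|ij] := eqVneq i j; have ji : j != i by [].
  by rewrite (tau_adjE ij) (tau_adjE ji) /tau (tau_class_eq (tau_sym ij ji)).
have tI i j x : tau_adj i j (tau_adj i j x) = tau_adj i j x.
  have [->|ij] := eqVneq i j; first by rewrite !tau_adj_id.
  have E := tau_class_eq (tau_idem ij); rewrite tau_classM in E.
  by rewrite !(tau_adjE ij) lmul_adjA E.
(* When indices coincide, [tau_path] and [tau_fork] follow from this relation, symmetry and
   idempotence. *)
have t_tri i j k x : i != j -> j != k ->
    tau_adj i j (tau_adj i k (tau_adj j k x)) = tau_adj i j (tau_adj j k x).
  move=> ij jk; have [<-|ik] := eqVneq i k; first by rewrite tau_adj_id.
  have E := tau_class_eq (tau_ij_ik_jk ij ik jk); rewrite !tau_classM in E.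
  by rewrite !(tau_adjE ij) !(tau_adjE jk) !(tau_adjE ik) !lmul_adjA E.
split=> //; first exact: tau_adj_id.
- move=> i j k l x ik il jk jl.
  have [->|ij] := eqVneq i j; first by rewrite !tau_adj_id.
  have [->|kl] := eqVneq k l; first by rewrite !tau_adj_id.
  have E := tau_class_eq (tau_ij_kl ij ik il jk jl kl); rewrite !tau_classM in E.
  by rewrite !(tau_adjE ij) !(tau_adjE kl) !lmul_adjA E.
- move=> i j k x ij.
  have [<-|jk] := eqVneq j k; first by rewrite tau_adj_id tI.
  have [<-|ik] := eqVneq i k; first by rewrite (tC j) !tI.
  have E := tau_class_eq (tau_ij_jk_ij ij ik jk); rewrite !tau_classM in E.
  by rewrite !(tau_adjE ij) !(tau_adjE jk) !lmul_adjA E.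
- move=> i j k l x ij kl.
  have [jk|jk] := eqVneq j k; first by rewrite -jk in kl *; rewrite tau_adj_id t_tri.
  have [<-|ik] := eqVneq i k; first by rewrite (tC j i) !tI.
  have [<-|jl] := eqVneq j l; first by rewrite (tC k j) !tI.
  have [<-|il] := eqVneq i l.
    by rewrite tau_adj_id (tC i j) (tC k i) t_tri.
  have E := tau_class_eq (tau_ij_jk_kl ij ik il jk jl kl); rewrite !tau_classM in E.
  by rewrite !(tau_adjE ij) !(tau_adjE jk) !(tau_adjE kl) !(tau_adjE il) !lmul_adjA E.
move=> i j k l x ij ik.
have [-> //|jk] := eqVneq j k.
have [<-|il] := eqVneq i l; first by rewrite (tC k) (tC j) !tI.
have [<-|jl] := eqVneq j l; first by rewrite tau_adj_id (tC i j) (tC k) t_tri.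
have [<-|kl] := eqVneq k l; first by rewrite tau_adj_id [RHS]tC t_tri // tC.
have E := tau_class_eq (tau_ij_kl_ik ij ik il jk jl kl); rewrite !tau_classM in E.
by rewrite !(tau_adjE ij) !(tau_adjE ik) !(tau_adjE kl) !(tau_adjE jl) !lmul_adjA E.
Qed.

End TauSemigroup.

(** * Images in the Brauer semigroup, and injectivity *)

Section Semantics.
Variables (n : nat) (X : Type) (t : 'I_n -> 'I_n -> X -> X) (o : X).
Hypothesis tP : tau_action t.
Variable ev : X -> brauer n.
Hypothesis ev_t : forall i j (ij : i != j) x, ev (t i j x) = sigma_elt ij * ev x.
Hypothesis ev_o : ev o = 1.
Implicit Types (a b c i j : 'I_n) (x y z : X) (f pi rho : 'S_n) (u v : points n).

Definition permute_upper pi u : points n := if u is inl k then inl (pi k) else u.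

(* The partner function of the image of e_f. *)
Definition paired f u : points n :=
  match u with
  | inl k => if f k == k then inr k else inl (f k)
  | inr k => if f k == k then inl k else inr (f k)
  end.

Lemma permute_upperM pi rho u :
  permute_upper (pi * rho) u = permute_upper rho (permute_upper pi u).
Proof. by case: u => //= k; rewrite permM. Qed.

Lemma permute_upper1 u : permute_upper 1 u = u.
Proof. by case: u => //= k; rewrite perm1. Qed.

Lemma paired_pair_up f i j : involutive f -> i != j -> f i = i -> f j = j ->
  hook i j (paired f) =1 paired (pair_up f i j).
Proof.
move=> fK ij fi fj u; rewrite /hook /= fi fj !eqxx.
have E := neqE ij.
case: u => m /=; rewrite !pair_upE //.
  have [->|mi] := eqVneq m i; first by rewrite /= !(pointE, eqxx, E).
  have [->|mj] := eqVneq m j; first by rewrite /= !(pointE, eqxx, E).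
  have [/negPf fmi /negPf fmj] := pair_up_neq fi fj mi mj.
  rewrite !pointE (negPf mi) (negPf mj).
  by case: (eqVneq (f m) m) => _; rewrite !pointE ?fmi ?fmj.
have [->|mi] := eqVneq m i; first by rewrite fi !(pointE, eqxx, E).
have [->|mj] := eqVneq m j; first by rewrite fj !(pointE, eqxx, E).
by case: (eqVneq (f m) m) => _; rewrite !pointE ?(negPf mi) ?(negPf mj).
Qed.

(** With d the partner of c, hooking b to c turns the blocks {a, b}, {c, d} into {b, c}, {a, d}: the
    upper points a and c are exchanged. *)
Lemma hook_tperm (p : points n -> points n) a b c : involutive p -> (forall u, p u != u) ->
    b != c -> p (inl a) = inl b -> forall u,
  hook b c p (permute_upper (tperm a c) u) = permute_upper (tperm a c) (p u).
Proof.
move=> pK pN bc pa; have pb : p (inl b) = inl a by rewrite -pa pK.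
have ab : a != b by have := pN (inl a); rewrite pa pointE eq_sym.
have fixE v : v != inl a -> v != inl c -> permute_upper (tperm a c) v = v.
  by case: v => //= k; rewrite !pointE => ka kc; rewrite tpermD // eq_sym.
have p_neq u v : v != p u -> p v != u by apply: contra_neq => <-; rewrite pK.
move=> u; rewrite /hook.
have [->|ua] := eqVneq u (inl a).
  by rewrite pa /= tpermL !(pointE, eqxx, neqE bc) /= tpermD // eq_sym.
have [uc|uc] := eqVneq u (inl c).
  have ac : a != c by move: ua; rewrite uc pointE eq_sym.
  rewrite uc /= tpermR !pointE (negPf ab) (negPf ac) pa eqxx fixE // p_neq // pa.
  by rewrite pointE eq_sym.
rewrite (fixE u) //.
have [->|ub] := eqVneq u (inl b); first by rewrite pb /= tpermL.
rewrite (negPf uc).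
have [pub|pub] := eqVneq (p u) (inl b).
  by case/eqP: ua; rewrite -[u]pK pub.
have [puc|puc] := eqVneq (p u) (inl c); first by rewrite puc pb /= tpermR.
by rewrite fixE // p_neq // pa.
Qed.

Lemma partner_reach f x pi y : involutive f -> has_holes t f x ->
    partner (ev x) =1 paired f -> reach t f x pi y ->
  forall u, partner (ev y) (permute_upper pi u) = permute_upper pi (paired f u).
Proof.
move=> fK fx xP yP; elim: yP => [|{}pi {}y a c yP IH fa] u.
  by rewrite !permute_upper1.
have pa : partner (ev y) (inl (pi a)) = inl (pi (f a)).
  by have := IH (inl a); rewrite /= (negPf fa).
rewrite !permute_upperM; have [<-|bc] := eqVneq (pi (f a)) c; last first.
  by rewrite ev_t partner_sigma (hook_tperm (@partnerK _ _) (partner_neq _) bc pa) IH.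
(* For [c = pi (f a)] the move is the identity, and the transposition only exchanges the two ends of
   one block. *)
rewrite (tau_id tP); have pb : partner (ev y) (inl (pi (f a))) = inl (pi a).
  by rewrite -pa partnerK.
rewrite -IH; move: (permute_upper pi u) => v.
have [->|va] := eqVneq v (inl (pi a)); first by rewrite /= tpermL pb pa /= tpermR.
have [->|vb] := eqVneq v (inl (pi (f a))); first by rewrite /= tpermR pa pb /= tpermL.
have fixE w : w != inl (pi a) -> w != inl (pi (f a)) ->
    permute_upper (tperm (pi a) (pi (f a))) w = w.
  by case: w => //= k; rewrite !pointE => ka kb; rewrite tpermD // eq_sym.
have inj := inj_eq (inv_inj (@partnerK n (ev y))).
by rewrite !fixE // ?(inj, =^~ pa) // -pb inj.
Qed.

Lemma partner_pairing_elt f : involutive f -> partner (ev (pairing_elt t o f)) =1 paired f.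
Proof.
move: f; apply: involution_ind => [|f i j fK ij fi fj IH] u.
  by rewrite pairing_elt1 ev_o partner1; case: u => k /=; rewrite perm1 eqxx.
rewrite (pairing_elt_add o tP ij fi fj) ev_t partner_sigma.
by rewrite (eq_hook _ _ IH) paired_pair_up.
Qed.

(** Upper permutations leave lower points alone, so the lower blocks of the image determine f. The
    image then determines pi up to a permutation that stabilizes f. *)
Lemma eval_inj (r s : seq ('I_n * 'I_n)) :
    all (fun p => p.1 != p.2) r -> all (fun p => p.1 != p.2) s ->
  let eval := foldr (fun p => t p.1 p.2) o in
  ev (eval r) = ev (eval s) -> eval r = eval s.
Proof.
move=> /(word_reach o tP)[f [pi [fK yP]]] /(word_reach o tP)[g [rho [gK zP]]] /=.
move: (foldr _ _ r) (foldr _ _ s) yP zP => y z yP zP yz.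
have fE := partner_reach fK (pairing_elt_holes o tP fK) (partner_pairing_elt fK) yP.
have gE := partner_reach gK (pairing_elt_holes o tP gK) (partner_pairing_elt gK) zP.
rewrite yz in fE.
have lower k : permute_upper pi (paired f (inr k)) = permute_upper rho (paired g (inr k)).
  by rewrite -fE -gE.
have fg : g = f.
  apply/permP=> k; have := lower k; rewrite /=.
  by case: eqVneq => [->|fk]; case: eqVneq => [->|gk] //= [].
rewrite {g}fg in gE gK zP lower.
apply: (reach_stabilizes_eq tP fK (pairing_elt_holes o tP fK) yP zP).
(* The lower ends of the lines show that pi and rho agree at the fixed points of f. *)
have gfix k : f k = k -> (pi * rho^-1) k = k.
  by move=> fk; have := lower k; rewrite /= fk eqxx /= permM => -[->]; rewrite permK.
split=> // k; have [fk|fk] := eqVneq (f k) k; first by rewrite fk gfix // fk.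
have := fE (inl k); have := gE (inl ((pi * rho^-1) k)).
rewrite /= (negPf fk) /= permM permKV => ->; case: eqVneq => //= _ [E].
by rewrite permM -E permK.
Qed.

End Semantics.

(** * Every Brauer element is the image of some e_f with its upper points permuted *)

Section UpperPermutation.
Variables (n : nat) (P : brauer n).
Implicit Types (k d e : 'I_n) (pi : 'S_n).
Let p := partner P.

(** The default k makes a fixed point of each k whose primed copy is joined to an upper point. *)
Definition lower_partner_fun k := if p (inr k) is inr l then l else k.

Lemma lower_partner_funK : involutive lower_partner_fun.
Proof.
move=> k; rewrite /lower_partner_fun; case E: (p (inr k)) => [l|l]; first by rewrite E.
by rewrite -E /p partnerK.
Qed.

Definition lower_partner : 'S_n := perm (inv_inj lower_partner_funK).
Let f := lower_partner.

Lemma lower_partnerK : involutive lower_partner.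
Proof. by move=> k; rewrite !permE lower_partner_funK. Qed.

Lemma lower_partner_fix k : f k = k -> exists e, p (inr k) = inl e.
Proof.
rewrite permE /lower_partner_fun; case E: (p (inr k)) => [e|l] lk; first by exists e.
by have := partner_neq P (inr k); rewrite -/p E lk eqxx.
Qed.

Lemma lower_partner_neq k : f k != k -> p (inr k) = inr (f k).
Proof. by rewrite /f permE /lower_partner_fun; case E: (p (inr k)) => [e|l] //; rewrite eqxx. Qed.

Definition matched pi k := p (inl (pi k)) == permute_upper pi (paired f (inl k)).

Lemma matched_tperm pi k d e :
    matched pi k -> pi k != d -> pi k != e -> pi (f k) != d -> pi (f k) != e ->
  matched (pi * tperm d e) k.
Proof.
rewrite /matched => /eqP pk kd ke fkd fke.
rewrite permute_upperM permM tpermD // pk /=.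
by case: ifP => //= _; rewrite tpermD.
Qed.

(* If some index fixed by f is not matched, match it; otherwise pi maps the
   indices moved by f onto the upper points not joined to lower points. *)
Lemma matched_step pi : ~~ [forall k, matched pi k] ->
  exists pi', [pred k | matched pi k] \proper [pred k | matched pi' k].
Proof.
rewrite negb_forall => /existsP[k0 bad0].
have pI u v : p u = v -> p v = u by move=> <-; rewrite /p partnerK.
have suff_swap k d e : ~~ matched pi k -> matched (pi * tperm d e) k ->
    (forall x, matched pi x -> [/\ pi x != d, pi x != e, pi (f x) != d & pi (f x) != e]) ->
    exists pi', [pred k | matched pi k] \proper [pred k | matched pi' k].
  move=> bad good keep; exists (pi * tperm d e); apply/properP; split.
    by apply/subsetP=> x; rewrite !inE => xm; have [? ? ? ?] := keep x xm; apply: matched_tperm.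
  by exists k; rewrite inE.
have matched_fix x : f x = x -> matched pi x = (p (inl (pi x)) == inr x).
  by move=> fx; rewrite /matched /= fx eqxx.
have matched_neq x : f x != x -> matched pi x = (p (inl (pi x)) == inl (pi (f x))).
  by move=> fx; rewrite /matched /= (negPf fx).
have [/existsP[k /andP[/eqP fk bad]]|/existsPn lines] :=
    boolP [exists k, (f k == k) && ~~ matched pi k].
  have [e pe] := lower_partner_fix fk.
  apply: (suff_swap k (pi k) e) => //.
    by rewrite /matched permM tpermL (pI _ _ pe) /= fk eqxx.
  move=> x xm; have xk : x != k by apply: contraNneq bad => <-.
  have fxk : f x != k by rewrite -fk (inj_eq perm_inj).
  rewrite !(inj_eq perm_inj) xk fxk; split=> //; apply/eqP=> E; move: xm.
    have [fx|fx] := eqVneq (f x) x.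
      by rewrite matched_fix // E (pI _ _ pe) => /eqP[kx]; rewrite kx eqxx in xk.
    by rewrite matched_neq // E (pI _ _ pe).
  have [fx|fx] := eqVneq (f x) x.
    by rewrite matched_fix // -fx E (pI _ _ pe) fx => /eqP[kx]; rewrite kx eqxx in xk.
  by rewrite matched_neq // E => /eqP/pI; rewrite (pI _ _ pe).
have fk0 : f k0 != k0 by have := lines k0; rewrite bad0 andbT.
have pk0 : p (inl (pi k0)) != inl (pi (f k0)) by rewrite -matched_neq.
(* No line starts at [pi k0]: lines are already matched, so the lower end e of such a line would
   give [pi e = pi k0], although f fixes e and moves k0. *)
case E: (p (inl (pi k0))) pk0 => [e|e] pk0; last first.
  have fe : f e = e.
    by apply: contraNeq fk0 => /lower_partner_neq; rewrite (pI _ _ E).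
  have := lines e; rewrite fe eqxx /= negbK matched_fix // => /eqP/pI.
  rewrite (pI _ _ E) => -[/perm_inj ke].
  by rewrite ke fe eqxx in fk0.
have ek0 : pi k0 != e.
  by have := partner_neq P (inl (pi k0)); rewrite -/p E pointE eq_sym.
(* After this exchange [f k0] is sent to e, the partner of [pi k0]. *)
apply: (suff_swap k0 (pi (f k0)) e) => //.
  rewrite /matched !permM tpermD ?(inj_eq perm_inj) //.
  by rewrite /= (negPf fk0) /= E permM tpermL.
move=> x xm; have xk : x != k0 by apply: contraNneq bad0 => <-.
have xfk : x != f k0.
  apply: contraNneq bad0 => xE; move: xm.
  rewrite xE !matched_neq ?(inj_eq perm_inj) // lower_partnerK => /eqP/pI ->.
  by rewrite eqxx.
rewrite !(inj_eq perm_inj); split=> //; apply/eqP=> xE; move: xm.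
  have [fx|fx] := eqVneq (f x) x; first by rewrite matched_fix // xE (pI _ _ E).
  rewrite matched_neq // xE (pI _ _ E) => /eqP[/perm_inj kE].
  by rewrite kE lower_partnerK eqxx in xfk.
have [fx|fx] := eqVneq (f x) x.
  by rewrite matched_fix // -fx xE (pI _ _ E).
rewrite matched_neq // xE => /eqP/pI; rewrite (pI _ _ E) => -[/perm_inj kE].
by rewrite kE eqxx in xk.
Qed.

(** By [matched_step], a permutation that matches the largest number of indices matches all of
    them. *)
Lemma upper_permutation_exists :
  exists pi, forall u, p (permute_upper pi u) = permute_upper pi (paired f u).
Proof.
suff [pi /forallP piP] : exists pi, [forall k, matched pi k].
  exists pi => -[k|k] /=; first exact/eqP/piP.
  have [fk|/lower_partner_neq //] := eqVneq (f k) k.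
  have := piP k; rewrite /matched /= fk eqxx => /eqP/= pk.
  by rewrite -pk /p partnerK.
pose pi := [arg max_(pi > (1 : 'S_n)) #|[pred k | matched pi k]|].
exists pi; apply: contraT => /matched_step[pi' /proper_card].
by rewrite ltnNge /pi; case: arg_maxnP => // rho _ max; case/negP; apply: max.
Qed.

End UpperPermutation.

(** * The homomorphism and its bijectivity *)

Section Isomorphism.
Variable n : nat.

Lemma eval_word_singular (w : free_semigroup (tau_symbol n)) :
  [predC @invertible_brauer n] (eval_word (val w)).
Proof.
case: w => -[|s w] //= _; elim: w s => [|s' w IH] s /=.
  by rewrite mulg1; apply: sigma_noninvertible.
by apply: noninvertible_closed; [apply: sigma_noninvertible | apply: IH].
Qed.

Lemma congruence_eval v w :
  congruence (@tau_relation n) v w -> eval_word (val v) = eval_word (val w).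
Proof.
elim=> {v w} [v w /sigma_relation//|//|v w _ ->//|u v w _ -> _ ->//|u u' v v' _ Eu _ Ev].
by rewrite /= !eval_cat Eu Ev.
Qed.

(** The choice of representative is immaterial by [congruence_eval]. *)
Definition eval_tau (x : tau_semigroup n) : singular_brauer n :=
  Sub (eval_word (val (generic_quotient.repr x))) (eval_word_singular (generic_quotient.repr x)).

Lemma eval_tau_pi w :
  val (eval_tau (\pi_(presented_semigroup (@tau_relation n)) w)) = eval_word (val w).
Proof. by apply/congruence_eval/eq_presentedP; rewrite generic_quotient.reprK. Qed.

Lemma eval_tauM : {morph eval_tau : x y / x * y >-> x * y}.
Proof.
elim/quotW=> v; elim/quotW=> w; apply: val_inj.
by rewrite -tau_classM [LHS]eval_tau_pi [LHS]eval_cat -2!eval_tau_pi.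
Qed.

HB.instance Definition _ :=
  isMultiplicative.Build (tau_semigroup n) (singular_brauer n) eval_tau eval_tauM.

Lemma eval_tauE i j (ij : i != j) : eval_tau (tau ij) = sigma ij.
Proof. by apply: val_inj; rewrite eval_tau_pi /= mulg1; apply: val_inj. Qed.

Variable phi : {multiplicative tau_semigroup n -> singular_brauer n}.
Hypothesis phi_tau : forall (i j : 'I_n) (ij : i != j), phi (tau ij) = sigma ij.

Definition eval_hom (x : option (tau_semigroup n)) : brauer n :=
  if x is Some y then val (phi y) else 1.

Lemma eval_hom_tau_adj i j (ij : i != j) x : eval_hom (tau_adj i j x) = sigma_elt ij * eval_hom x.
Proof.
rewrite (tau_adjE ij) /=; case: x => [x|] /=; last by rewrite phi_tau mulg1.
by rewrite gmulfM phi_tau.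
Qed.

Lemma tau_word_ex (x : tau_semigroup n) : exists s : seq ('I_n * 'I_n),
  all (fun p => p.1 != p.2) s /\ Some x = foldr (fun p => @tau_adj n p.1 p.2) None s.
Proof.
elim/quotW: x => -[w w0]; exists (map val w); split.
  by apply/allP=> p /mapP[s _ ->]; apply: (valP s).
have tau_adj_val s x : tau_adj (val s).1 (val s).2 x =
    lmul_adj (\pi_(presented_semigroup (@tau_relation n)) (letter s)) x.
  by rewrite /tau_adj -surjective_pairing valK.
elim: w w0 => [|s [|s' w] IH] //= w0.
  by rewrite tau_adj_val /=; congr (Some (\pi_(presented_semigroup _) _)); apply: val_inj.
move: (IH isT) => /= <-; rewrite tau_adj_val /=; congr Some; rewrite -tau_classM.
by congr (\pi_(presented_semigroup _) _); apply: val_inj.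
Qed.

Lemma tau_hom_inj : injective phi.
Proof.
move=> x y; have [r [rP xE]] := tau_word_ex x; have [s [sP yE]] := tau_word_ex y.
move=> /(congr1 val) xy; apply: Some_inj; rewrite xE yE.
apply: (eval_inj (o := None) (@tau_adj_action n) eval_hom_tau_adj) => //.
by rewrite -xE -yE.
Qed.

(** Moves from e_f realise the upper permutation pi of P. They require a pair of f, which exists
    because otherwise all blocks of P would be lines and P would be invertible. *)
Lemma tau_hom_surj P : exists x, phi x == P.
Proof.
have [pi piP] := upper_permutation_exists (val P).
have fK := lower_partnerK (val P); set f := lower_partner (val P) in piP fK.
have [a fa] : exists a, f a != a.
  apply/existsP; apply: contraT => /existsPn f1; case/negP: (valP P) => /=.
  apply/invertible_brauerP => B BP.
  have line k : partner (val P) (inl (pi k)) = inr k.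
    by have := piP (inl k); rewrite /= (negPn (f1 k)).
  have /card_gt0P[u uB] : 0 < #|B|.
    by have /andP[_ /forall_inP/(_ B BP)/eqP->] := valP (val P).
  have /and3P[_ tP _] := brauer_partition (val P).
  have /andP[_ /eqP] := pblock_partner (val P) u; rewrite (def_pblock tP BP uB) => ->.
  case: u {uB} => k; first by exists k, (pi^-1 k); rewrite -[k in inl k](permKV pi) line.
  by exists (pi k), k; rewrite -(line k) partnerK setUC.
have fx := pairing_elt_holes None (@tau_adj_action n) fK.
have [y yP] := @reach_ex _ _ (@tau_adj n) f (pairing_elt (@tau_adj n) None f) a fa pi.
have yE := partner_reach (@tau_adj_action n) eval_hom_tau_adj fK fx
  (@partner_pairing_elt _ _ _ None (@tau_adj_action n) eval_hom eval_hom_tau_adj erefl f fK) yP.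
have {yE yP} : eval_hom y = val P.
  apply: partner_inj => u; rewrite -[u](permute_upper1) -(mulVg pi) permute_upperM.
  by rewrite piP yE.
(* The adjoined identity is excluded, its image being invertible. *)
case: y => [x|] /= E; first by exists x; apply/eqP/val_inj.
have inv1 : (1 : brauer n) \in @invertible_brauer n.
  by apply/existsP; exists 1; rewrite mulg1 eqxx.
by case/negP: (valP P); rewrite E in inv1.
Qed.

End Isomorphism.

Theorem theorem5 (n : nat) (n_gt0 : 0 < n) :
  (exists phi : {multiplicative tau_semigroup n -> singular_brauer n},
     forall (i j : 'I_n) (ij : i != j), phi (tau ij) = sigma ij) /\
  (forall phi : {multiplicative tau_semigroup n -> singular_brauer n},
     (forall (i j : 'I_n) (ij : i != j), phi (tau ij) = sigma ij) ->
     bijective phi).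
Proof.
split; first by exists (@eval_tau n); apply: eval_tauE.
move=> phi phi_tau; have tau_hom_surj := tau_hom_surj phi_tau.
exists (fun P => xchoose (tau_hom_surj P)) => [x|P]; last exact/eqP/(xchooseP (tau_hom_surj P)).
by apply: (tau_hom_inj phi_tau); apply/eqP/(xchooseP (tau_hom_surj (phi x))).
Qed.
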